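(* Let $\varphi_1,\dots,\varphi_n$ be $n$ analytically independent meromorphic functions on $\mathbb{C}^n$ such that $\Phi=(\varphi_1,\dots,\varphi_n)$ admits an algebraic addition theorem (AAT). Then the $n^2$ partial derivatives $\frac{\partial\varphi_k}{\partial u_p}(u)$, $k,p=1,\dots,n$, generate a simple algebraic extension $F$ of the field $\mathbb{C}(\varphi_1,\dots,\varphi_n)$ of rational functions of $\varphi_1(u),\dots,\varphi_n(u)$ with complex coefficients. For suitable $\alpha_{kp}\in\mathbb{C}$ the function $$\theta(u):=\sum_{k,p=1}^n\alpha_{kp}\,\frac{\partial\varphi_k}{\partial u_p}(u)$$ is a primitive element of $F$, and the minimal polynomial $V(\theta;x_1,\dots,x_n)$ of this extension is satisfied by $x_1=\varphi_1(u),\dots,x_n=\varphi_n(u)$ and $\theta=\theta(u)$, i.e. $$V\{\theta(u);\varphi_1(u),\dots,\varphi_n(u)\}=0 .$$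
   Context: Here $u=(u_1,\dots,u_n)\in\mathbb{C}^n$. Meromorphic functions $\varphi_1,\dots,\varphi_n$ on $\mathbb{C}^n$ are analytically independent if the Jacobian determinant $\det[\partial\varphi_k/\partial u_p]$ does not vanish identically. They define the meromorphic mapping $\Phi:u\mapsto(\varphi_1(u),\dots,\varphi_n(u))$ from $\mathbb{C}^n$ to $\overline{\mathbb{C}}^n$ (the product of $n$ Riemann spheres). $\Phi$ admits an algebraic addition theorem (AAT) if there exist $n$ polynomials $G_k(\lambda;x_1,\dots,x_n,y_1,\dots,y_n)\not\equiv 0$, $k=1,\dots,n$, in $2n+1$ variables with complex coefficients such that $$G_k\{\varphi_k(u+v);\varphi_1(u),\dots,\varphi_n(u),\varphi_1(v),\dots,\varphi_n(v)\}=0,\qquad k=1,\dots,n,$$ identically as meromorphic functions of $(u,v)\in\mathbb{C}^n\times\mathbb{C}^n$ (none of the denominators vanishing identically). All fields are subfields of the field of meromorphic functions on $\mathbb{C}^n$. The minimal polynomial $V$ of the extension is the minimal polynomial of $\theta$ over $\mathbb{C}(\varphi_1,\dots,\varphi_n)$, written (after clearing denominators) as a polynomial in $\theta$ and $x_1,\dots,x_n$ with complex coefficients, where $x_j$ stands for $\varphi_j$. *)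

(* Defs.v *)
From HB Require Import structures.
From mathcomp Require Import all_boot all_order all_algebra.
From mathcomp Require Import complex.
(* The notations of mpoly clash with those of topology and normedtype. *)
From mathcomp Require Import -(notations) mpoly.
From mathcomp Require Import boolp classical_sets functions reals.
From mathcomp Require Import topology normedtype sequences derive.

Set Implicit Arguments.
Unset Strict Implicit.
Unset Printing Implicit Defensive.

Import Order.TTheory GRing.Theory Num.Theory numFieldNormedType.Exports.
Local Open Scope classical_set_scope.
Local Open Scope ring_scope.

(* [Cx R] is [R[i]] behind a [numClosedFieldType], which is
   what makes its topology (and that of ['rV_n]) available to inference. *)
Definition Cx (R : realType) : numClosedFieldType := R[i].

Notation fn R n := ('rV[Cx R]_n -> Cx R).

(* Meromorphic functions are represented by total functions, whose values on a
   closed nowhere dense set (poles, points of indeterminacy) are irrelevant.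
   Two of them are equal as meromorphic functions when they agree on a dense
   open set, i.e. when [f =m g] below. *)
Definition generically (T : topologicalType) (P : T -> Prop) : Prop :=
  exists W : set T, [/\ open W, dense W & forall x, W x -> P x].

Definition eqm (R : realType) (n : nat) (f g : fn R n) : Prop :=
  generically (fun u => f u = g u).

Notation "f =m g" := (eqm f g) (at level 70, no associativity).

(* The sum of the terms of total degree [< N] of the power series [c] at [z]. *)
Definition power_sum (R : realType) (n : nat)
    (c : multinom n -> Cx R) (z : 'rV[Cx R]_n) (N : nat) : Cx R :=
  \sum_(m : bmultinom n N)
    c (bmnm m) * mmap1 (fun i => z 0 i) (bmnm m).

Definition power_norm_sum (R : realType) (n : nat)
    (c : multinom n -> Cx R) (z : 'rV[Cx R]_n) (N : nat) : Cx R :=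
  \sum_(m : bmultinom n N)
    `|c (bmnm m) * mmap1 (fun i => z 0 i) (bmnm m)|.

(* Holomorphy at [a]: near [a], [f] is the sum of a power series that converges
   absolutely on a polydisc centred at [a]. *)
Definition holomorphic_at (R : realType) (n : nat)
    (f : fn R n) (a : 'rV[Cx R]_n) : Prop :=
  exists (r : Cx R) (c : multinom n -> Cx R),
    0 < r /\
    forall z : 'rV[Cx R]_n, (forall i, `|z 0 i| < r) ->
      cvgn (power_norm_sum c z) /\ power_sum c z @ \oo --> f (a + z).

(* Locally a quotient [g / h] of holomorphic functions; the denominator may not
   vanish identically on any nonempty open set. *)
Definition meromorphic (R : realType) (n : nat) (f : fn R n) : Prop :=
  forall a : 'rV[Cx R]_n, exists (U : set 'rV[Cx R]_n) (g h : fn R n),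
    [/\ open U, U a,
        forall z, U z -> holomorphic_at g z /\ holomorphic_at h z
      & generically (fun z => U z -> h z != 0 /\ f z = g z / h z)].

Definition partial (R : realType) (n : nat) (p : 'I_n) (f : fn R n) : fn R n :=
  fun u => 'D_(delta_mx 0 p) f u.

Definition analytically_independent (R : realType) (n : nat)
    (phi : 'I_n -> fn R n) : Prop :=
  ~ (fun u => \det (\matrix_(k < n, p < n) partial p (phi k) u)) =m 0.

Definition Phi (R : realType) (n : nat) (phi : 'I_n -> fn R n)
    (u : 'rV[Cx R]_n) : 'rV[Cx R]_n := \row_k phi k u.

(* The variables of [G k] are, in this order, lambda, x_1..x_n, y_1..y_n. *)
Definition AAT (R : realType) (n : nat) (phi : 'I_n -> fn R n) : Prop :=
  exists G : 'I_n -> mpoly (1 + (n + n)) (Cx R), forall k,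
    G k != 0 /\
    generically (fun uv : 'rV[Cx R]_n * 'rV[Cx R]_n =>
      meval
        (fun i => row_mx (phi k (uv.1 + uv.2))%:M
                         (row_mx (Phi phi uv.1) (Phi phi uv.2)) 0 i)
        (G k) = 0).

(* Fields of meromorphic functions are sets of representatives closed under
   [=m]; the pointwise inverse of a representative that is not [=m 0]
   represents its inverse, and that of one that is [=m 0] is again [=m 0]. *)
Definition subfield (R : realType) (n : nat) (K : set (fn R n)) : Prop :=
  [/\ forall f, K f -> meromorphic f,
      forall f g, f =m g -> K f -> K g,
      K 1,
      forall f g, K f -> K g -> K (f - g) /\ K (f * g)
    & forall f, K f -> K (fun u => (f u)^-1)].

Definition adjoin (R : realType) (n : nat) (K S : set (fn R n)) :
    set (fn R n) :=
  [set f | forall L, subfield L -> K `<=` L -> S `<=` L -> L f].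

Definition pullback (R : realType) (n : nat) (phi : 'I_n -> fn R n)
    (P : mpoly n (Cx R)) : fn R n :=
  fun u => meval (fun j => phi j u) P.

(* The field C(phi_1, ..., phi_n). *)
Definition ratfield (R : realType) (n : nat) (phi : 'I_n -> fn R n) :
    set (fn R n) :=
  [set f | exists P Q : mpoly n (Cx R),
     ~ pullback phi Q =m 0 /\
     f =m (fun u => pullback phi P u / pullback phi Q u)].

Definition poly_over (R : realType) (n : nat) (K : set (fn R n))
    (p : {poly fn R n}) : Prop := forall i, K p`_i.

Definition algebraic_over (R : realType) (n : nat) (K : set (fn R n))
    (f : fn R n) : Prop :=
  exists p : {poly fn R n},
    [/\ poly_over K p, exists i, ~ p`_i =m 0 & p.[f] =m 0].

Definition algebraic_extension (R : realType) (n : nat)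
    (K F : set (fn R n)) : Prop :=
  [/\ subfield K, subfield F, K `<=` F & forall f, F f -> algebraic_over K f].

Definition primitive_element (R : realType) (n : nat) (K F : set (fn R n))
    (theta : fn R n) : Prop := F theta /\ F = adjoin K [set theta].

Definition simple_algebraic_extension (R : realType) (n : nat)
    (K F : set (fn R n)) : Prop :=
  algebraic_extension K F /\ exists theta, primitive_element K F theta.

Definition is_minpoly (R : realType) (n : nat) (K : set (fn R n))
    (theta : fn R n) (p : {poly fn R n}) : Prop :=
  [/\ poly_over K p, p \is monic, p.[theta] =m 0
    & forall q : {poly fn R n}, poly_over K q -> q \is monic ->
        q.[theta] =m 0 -> (size p <= size q)%N].

(* The polynomial [V], in theta over the polynomials in x_1..x_n, is the minimal
   polynomial of [theta] over C(phi) with denominators cleared: for x_j = phi_j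
   it becomes that minimal polynomial times some nonzero [D(phi)]. *)
Definition cleared_minpoly (R : realType) (n : nat) (phi : 'I_n -> fn R n)
    (theta : fn R n) (V : {poly mpoly n (Cx R)}) : Prop :=
  exists (p : {poly fn R n}) (D : mpoly n (Cx R)),
    [/\ is_minpoly (ratfield phi) theta p,
        ~ pullback phi D =m 0
      & forall i, pullback phi V`_i =m pullback phi D * p`_i].

Definition lin_comb_partials (R : realType) (n : nat) (phi : 'I_n -> fn R n)
    (alpha : 'M[Cx R]_n) : fn R n :=
  fun u => \sum_(k < n) \sum_(p < n) alpha k p * partial p (phi k) u.

(* Main.v *)
(* For a generic fixed v, put psi_k(u) = phi_k(u + v), and let G_k be a nonzero
   relation of minimal degree of the addition theorem. By minimality the derivative
   of G_k in lambda does not vanish on the relation: otherwise it would be 0, the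
   derivatives in x and y would be 0 too because the Jacobian matrix is invertible,
   and G_k would be a constant. Hence psi_k is algebraic over K = C(phi), as a
   simple root of G_k(., phi, phi(v)). Differentiating the relation in u and in v
   expresses the same multiple of the derivatives of psi_k in two ways; equating
   them gives a linear system A J = B for the Jacobian matrix J of phi, where A is
   invertible and A, B have coefficients in K(psi). So the partial derivatives are
   algebraic over K, and in characteristic 0 a linear combination with constant
   coefficients is a primitive element.
   Meromorphic functions form a field by the identity theorem, proved by
   propagating zeros along real segments, with local expansions obtained by
   restricting holomorphic functions to complex lines. *)
Require Import Defs.
From HB Require Import structures.
From mathcomp Require Import all_boot all_order all_algebra.
From mathcomp Require Import generic_quotient ring_quotient perm separable.
From mathcomp Require Import ring.
From mathcomp Require Import complex.
From mathcomp Require Import -(notations) mpoly.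
From mathcomp Require Import boolp classical_sets functions reals.
From mathcomp Require Import topology normedtype sequences derive.

Set Implicit Arguments.
Unset Strict Implicit.
Unset Printing Implicit Defensive.

Import Order.TTheory GRing.Theory Num.Theory numFieldNormedType.Exports.
Local Open Scope classical_set_scope.
Local Open Scope ring_scope.

(** * Polynomials and their l1 norms *)

(** The addition theorem is a relation between meromorphic functions of [(u, v)], but the argument
    needs it with [v] fixed, and a dense open subset of the product may miss a whole slice. It is
    therefore first turned into an identity at all pairs for which [u], [v] and [u + v] are regular
    points, by applying the identity theorem to one argument at a time. The translate
    [phi k (u + v)] has the same partial derivatives in [u] and in [v]. Differentiating in [u]
    brings in the unknown Jacobian matrix [J] of [phi], whereas differentiating in [v] and then
    fixing [v] brings in only the complex numbers [partial p (phi j) v]. This is why the right-hand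
    side [B] is known. The matrix [A] is invertible because [A J] is, up to sign, an invertible
    diagonal matrix times the Jacobian matrix of the translates. Degree means total degree, so that
    one minimal choice controls the derivatives in lambda, in the [x_j] and in the [y_j]
    together. *)

Section MpolyInd.
Variables (C : comNzRingType) (n : nat).

(** Evaluation, continuity and chain rules are compatible with sums and products; this principle
    spares them the expansion into monomials. *)
Lemma mpoly_ring_ind (P : mpoly n C -> Prop) :
    (forall c, P (mpolyC n c)) -> (forall i, P (mpolyX C (mnm1 i))) ->
    (forall p q, P p -> P q -> P (p + q)) ->
    (forall p q, P p -> P q -> P (p * q)) ->
  forall p, P p.
Proof.
move=> PC PX PD PM p; rewrite [p]mpolyE.
elim/big_ind: _ => [|//|m _]; first by rewrite -mpolyC0.
rewrite -mul_mpolyC mpolyXE_id; apply: (PM) => //.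
elim/big_ind: _ => [|//|i _]; first by rewrite -mpolyC1.
by elim: (m i) => [|k IH]; rewrite ?expr0 -?mpolyC1 // exprS; apply: PM.
Qed.

End MpolyInd.

Section MpolyNorm.
Variables (C : numFieldType) (n : nat).
Implicit Types (p q : mpoly n C) (s t : C) (m : multinom n).

(** The l1 norm weighted by the radius [s]. For [0 < s] it is submultiplicative, bounds the values
    on the closed polydisc of radius [s], and bounds each coefficient up to a power of [s]. *)
Definition mnorm s p := \sum_(m <- msupp p) `|mcoeff m p| * s ^+ mdeg m.

Lemma mnormE s p (r : seq (multinom n)) : uniq r -> {subset msupp p <= r} ->
  mnorm s p = \sum_(m <- r) `|mcoeff m p| * s ^+ mdeg m.
Proof.
move=> ur sr; rewrite [RHS](bigID (mem (msupp p))) /=.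
rewrite [X in _ + X]big1 ?addr0 => [|m /memN_msupp_eq0 ->]; last first.
  by rewrite normr0 mul0r.
rewrite -big_filter; apply: perm_big; apply: uniq_perm.
- exact: msupp_uniq.
- exact: filter_uniq.
by move=> m; rewrite mem_filter; case: (boolP (m \in msupp p)) => // /sr ->.
Qed.

Lemma mnorm_ge0 s p : 0 <= s -> 0 <= mnorm s p.
Proof. by move=> s0; apply: sumr_ge0 => m _; rewrite mulr_ge0 ?exprn_ge0. Qed.

Lemma mnormD s p q : 0 <= s -> mnorm s (p + q) <= mnorm s p + mnorm s q.
Proof.
move=> s0; pose r := undup (msupp p ++ msupp q).
have ur : uniq r by apply: undup_uniq.
rewrite !(mnormE _ ur).
- rewrite -big_split /=; apply: ler_sum => m _.
  by rewrite -mulrDl mcoeffD ler_wpM2r ?exprn_ge0 ?ler_normD.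
- by move=> m; rewrite mem_undup mem_cat orbC => ->.
- by move=> m; rewrite mem_undup mem_cat => ->.
- by move=> m; rewrite mem_undup => /msuppD_le.
Qed.

Lemma mnorm0 s : mnorm s 0 = 0.
Proof. by rewrite /mnorm msupp0 big_nil. Qed.

Lemma mnormN s p : mnorm s (- p) = mnorm s p.
Proof.
rewrite /mnorm (perm_big _ (msuppN p)) /=.
by apply: eq_bigr => m _; rewrite mcoeffN normrN.
Qed.

Lemma mnormZX s (c : C) m : mnorm s (c *: mpolyX C m) = `|c| * s ^+ mdeg m.
Proof.
have [->|c0] := eqVneq c 0; first by rewrite scale0r mnorm0 normr0 mul0r.
by rewrite /mnorm msuppMCX // big_seq1 mcoeffZ mcoeffX eqxx mulr1.
Qed.

Lemma mnorm_sum s (I : Type) (r : seq I) (P : pred I) (F : I -> mpoly n C) :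
  0 <= s -> mnorm s (\sum_(i <- r | P i) F i) <= \sum_(i <- r | P i) mnorm s (F i).
Proof.
move=> s0; elim/big_rec2: _ => [|i y x _ yx]; first by rewrite mnorm0.
by apply: le_trans (mnormD _ _ s0) _; rewrite lerD2l.
Qed.

Lemma mnormM s p q : 0 <= s -> mnorm s (p * q) <= mnorm s p * mnorm s q.
Proof.
move=> s0; rewrite {1}[p]mpolyE mulr_suml.
apply: le_trans (mnorm_sum _ _ _ s0) _.
rewrite [mnorm s p in leRHS]/mnorm mulr_suml; apply: ler_sum => m _.
rewrite {1}[q]mpolyE mulr_sumr.
apply: le_trans (mnorm_sum _ _ _ s0) _.
rewrite [mnorm s q in leRHS]/mnorm mulr_sumr; apply: ler_sum => m' _.
rewrite -scalerAl -scalerAr scalerA -mpolyXD mnormZX normrM mdegD exprD.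
by rewrite mulrACA.
Qed.

(** A monomial of degree [d] shrinks by the factor [(t / s) ^+ d] when the radius passes from [s] to
    [t], and [t / s <= 1]. The geometric decay of remainders comes from here. *)
Lemma mnorm_order s t p N : 0 <= t -> 0 < s -> t <= s ->
    (forall m, m \in msupp p -> (N <= mdeg m)%N) ->
  mnorm t p <= (t / s) ^+ N * mnorm s p.
Proof.
move=> t0 s0 ts ordp; have s1 := ltW s0; rewrite mulr_sumr /mnorm.
rewrite big_seq [leRHS]big_seq; apply: ler_sum => m /ordp Nm.
rewrite mulrCA ler_wpM2l // -{1}[t](divfK (lt0r_neq0 s0)) exprMn.
by rewrite ler_wpM2r ?exprn_ge0 // ler_wiXn2l ?divr_ge0 ?ler_pdivrMr ?mul1r.
Qed.

(** Stated for an abstract submultiplicative [nu] in order to serve twice: for the absolute value of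
    an evaluation and for the coefficient norm of a restriction to a line. *)
Lemma mnorm_mmap (A : comNzRingType) (f : {rmorphism C -> A}) (nu : A -> C)
    (h : 'I_n -> A) s p :
    (forall x, 0 <= nu x) ->
    (forall x y, nu (x + y) <= nu x + nu y) ->
    (forall x y, nu (x * y) <= nu x * nu y) ->
    (forall c, nu (f c) <= `|c|) -> (forall i, nu (h i) <= s) ->
  nu (mmap f h p) <= mnorm s p.
Proof.
move=> nu0 nuD nuM nuf nuh.
have nu00 : nu 0 = 0.
  by apply/eqP; rewrite eq_le nu0 andbT; have := nuf 0; rewrite rmorph0 normr0.
rewrite /mmap /mnorm; elim/big_rec2: _ => [|m y x _ yx]; first by rewrite nu00.
apply: le_trans (nuD _ _) _; apply: lerD yx.
apply: le_trans (nuM _ _) _; apply: ler_pM => //.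
rewrite /mmap1 mdegE expr_sum; elim/big_rec2: _ => [|i z w _ zw].
  by have := nuf 1; rewrite rmorph1 normr1.
apply: le_trans (nuM _ _) _; apply: ler_pM => //.
elim: (m i) => [|k IH]; first by have := nuf 1; rewrite rmorph1 normr1.
by rewrite !exprS; apply: le_trans (nuM _ _) _; apply: ler_pM.
Qed.

Lemma norm_meval_le s p (z : 'I_n -> C) :
  (forall i, `|z i| <= s) -> `|meval z p| <= mnorm s p.
Proof.
move=> zs; apply: mnorm_mmap => //; first exact: ler_normD.
by move=> x y; rewrite normrM.
Qed.

End MpolyNorm.

(** * Formal chain rule for substitution into polynomials *)

Section ChainRule.
Variables (C : comNzRingType) (n : nat) (A B : comNzRingType).
Variables (f : {rmorphism C -> A}) (g : {rmorphism C -> B}).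

(* [S x e d] reads: at some point, [x] has value [e] and derivative [d]. *)
Lemma mmap_chain_rule (S : A -> B -> B -> Prop)
    (h : 'I_n -> A) (e d : 'I_n -> B) (p : mpoly n C) :
    (forall c, S (f c) (g c) 0) ->
    (forall x a u y b v, S x a u -> S y b v -> S (x + y) (a + b) (u + v)) ->
    (forall x a u y b v, S x a u -> S y b v ->
      S (x * y) (a * b) (u * b + a * v)) ->
    (forall i, S (h i) (e i) (d i)) ->
  S (mmap f h p) (mmap g e p) (\sum_i mmap g e (mderiv i p) * d i).
Proof.
move=> SC SD SM Sh; elim/mpoly_ring_ind: p => [c|i|p q Sp Sq|p q Sp Sq].
- rewrite !mmapC big1 => [|i _]; first exact: SC.
  by rewrite mderivC mmap0 mul0r.
- rewrite !mmapX !mmap1U (bigD1 i) //= big1 => [|j ji]; last first.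
    by rewrite mderivX mnm1E eq_sym (negbTE ji) scale0r mmap0 mul0r.
  have subU : mnm_sub (mnm1 i) (mnm1 i) = mnm0 by rewrite -{1}[mnm1 i]add0m addmK.
  rewrite mderivX mnm1E eqxx subU mpolyX0 scale1r rmorph1 mul1r addr0; exact: Sh.
- rewrite !mmapD; under eq_bigr do rewrite mderivD mmapD mulrDl.
  by rewrite big_split; apply: SD.
rewrite !rmorphM; under eq_bigr do rewrite mderivM mmapD !rmorphM mulrDl mulrAC -[X in _ + X]mulrA.
by rewrite big_split -mulr_suml -mulr_sumr; apply: SM.
Qed.

End ChainRule.

(** * Restriction of polynomials to complex lines *)

Section LineRestriction.
Variables (C : numFieldType) (n : nat).
Implicit Types (p : mpoly n C) (q : {poly C}).

Definition pnorm q := \sum_(j < size q) `|q`_j|.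

Lemma pnormE q N : (size q <= N)%N -> pnorm q = \sum_(j < N) `|q`_j|.
Proof.
move=> qN; rewrite /pnorm (big_ord_widen N (fun j => `|q`_j|) qN) big_mkcond.
apply: eq_bigr => j _; case: ltnP => // qj.
by rewrite nth_default ?normr0.
Qed.

Lemma pnorm_ge0 q : 0 <= pnorm q.
Proof. exact: sumr_ge0. Qed.

Lemma pnormD q r : pnorm (q + r) <= pnorm q + pnorm r.
Proof.
have le := size_polyD q r; rewrite (pnormE le).
rewrite (pnormE (leq_maxl _ (size r))) (pnormE (leq_maxr (size q) _)).
by rewrite -big_split; apply: ler_sum => j _; rewrite coefD ler_normD.
Qed.

Lemma pnormZ c q : pnorm (c *: q) <= `|c| * pnorm q.
Proof.
rewrite (pnormE (size_scale_leq c q)) mulr_sumr.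
by apply: ler_sum => j _; rewrite coefZ normrM.
Qed.

Lemma pnormC c : pnorm c%:P = `|c|.
Proof. by rewrite (pnormE (size_polyC_leq1 c)) big_ord1 coefC. Qed.

Lemma pnormMX q : pnorm (q * 'X) = pnorm q.
Proof.
rewrite (@pnormE (q * 'X) (size q).+1); last first.
  by apply: leq_trans (size_polyMleq _ _) _; rewrite size_polyX addn2.
rewrite big_ord_recl coefMX normr0 add0r; apply: eq_bigr => j _.
by rewrite coefMX.
Qed.

Lemma pnormM q r : pnorm (q * r) <= pnorm q * pnorm r.
Proof.
elim/poly_ind: q => [|q c IH]; first by rewrite mul0r -polyC0 pnormC normr0 mul0r.
rewrite mulrDl mulrAC mul_polyC; apply: le_trans (pnormD _ _) _.
rewrite pnormMX; apply: (@le_trans _ _ ((pnorm q + `|c|) * pnorm r)).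
  by rewrite mulrDl lerD ?pnormZ.
rewrite ler_wpM2r ?pnorm_ge0 // (@pnormE (q * 'X + c%:P) (size q).+1); last first.
  apply: leq_trans (size_polyD _ _) _; rewrite geq_max.
  rewrite (leq_trans (size_polyMleq _ _)) ?size_polyX ?addn2 //.
  by rewrite (leq_trans (size_polyC_leq1 _)).
rewrite big_ord_recl addrC coefD coefMX coefC eqxx add0r lerD2l.
apply: ler_sum => j _; by rewrite coefD coefMX coefC /= addr0.
Qed.

Lemma coef_norm_le q j : `|q`_j| <= pnorm q.
Proof.
have [qj|jq] := leqP (size q) j; first by rewrite nth_default ?normr0 ?pnorm_ge0.
by rewrite /pnorm (bigD1 (Ordinal jq)) //= lerDl sumr_ge0.
Qed.

Definition line (b w : 'I_n -> C) p : {poly C} :=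
  mmap polyC (fun i => (b i)%:P + w i *: 'X) p.

(** The hypothesis keeps the disc [|t| <= 1] of the line inside the polydisc of radius [s]; the
    bound is the same for all such lines. *)
Lemma pnorm_line b w s p : (forall i, `|b i| + `|w i| <= s) ->
  pnorm (line b w p) <= mnorm s p.
Proof.
move=> bws; apply: mnorm_mmap => [| | |c|i].
- exact: pnorm_ge0.
- exact: pnormD.
- exact: pnormM.
- by rewrite pnormC.
- apply: le_trans (bws i); apply: le_trans (pnormD _ _) _.
  rewrite pnormC lerD2l; apply: le_trans (pnormZ _ _) _.
  by rewrite -['X]mul1r pnormMX -polyC1 pnormC normr1 mulr1.
Qed.

Lemma lineB b w p (q : mpoly n C) : line b w (p - q) = line b w p - line b w q.
Proof. exact: mmapB. Qed.

Lemma horner_line b w p t : (line b w p).[t] = meval (fun i => b i + t * w i) p.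
Proof.
elim/mpoly_ring_ind: p => [c|i|p q IHp IHq|p q IHp IHq].
- by rewrite /line mmapC mevalC hornerC.
- by rewrite /line mmapX mmap1U mevalXU hornerD hornerC hornerZ hornerX mulrC.
- by rewrite /line mmapD hornerD mevalD -IHp -IHq.
- by rewrite /line rmorphM hornerM mevalM -IHp -IHq.
Qed.

(** The chain rule [mmap_chain_rule] read modulo [t ^ 2]: value and derivative are the coefficients
    of degree 0 and 1. *)
Lemma coef1_line b w p :
  (line b w p)`_1 = \sum_i meval b (mderiv i p) * w i.
Proof.
pose S (q : {poly C}) a u := q`_0 = a /\ q`_1 = u.
suff: S (line b w p) (meval b p) (\sum_i meval b (mderiv i p) * w i) by case.
apply: mmap_chain_rule => [c|x a u y c v|x a u y c v|i]; rewrite /S.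
- by rewrite !coefC.
- by rewrite !coefD => -[-> ->] [-> ->].
- move=> [<- <-] [<- <-]; rewrite !coefM big_ord1 big_ord_recr big_ord1 /=.
  by rewrite addrC.
- by rewrite !coefD !coefC !coefZ !coefX /= mulr0 mulr1 addr0 add0r.
Qed.

End LineRestriction.

(** * Holomorphic functions as limits of polynomials *)

Section CxSequences.
Variable R : realType.
Implicit Types (u : nat -> Cx R) (l : Cx R).

Lemma cvgn_dist (K : numFieldType) (u : nat -> K) (l : K) :
  u @ \oo --> l <->
  forall e, 0 < e -> exists N, forall k, (N <= k)%N -> `|l - u k| < e.
Proof.
split=> [/cvgrPdist_lt ul e /ul [N _ Nu]|ul].
  by exists N => k; apply: Nu.
by apply/cvgrPdist_lt => e /ul [N Nu]; exists N.
Qed.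

Lemma norm_cx_le (x : Cx R) :
  `|x| <= real_complex R (`|complex.Re x| + `|complex.Im x|) :> Cx R.
Proof.
case: x => a b; change (`|Complex a b| <= (`|a| + `|b|)%:C%C).
rewrite normc_def lecR /= -[leRHS]ger0_norm ?addr_ge0 // -[leRHS]sqrtr_sqr.
rewrite ler_wsqrtr // sqrrD !real_normK ?num_real // -addrA lerD2l.
by rewrite lerDr mulrn_wge0 ?mulr_ge0.
Qed.

Lemma Re_norm_le (x : Cx R) : real_complex R `|complex.Re x| <= `|x| :> Cx R.
Proof. exact: normc_ge_Re. Qed.

Lemma cauchy_cvg_real (u : nat -> R) :
    (forall e, 0 < e -> exists N, forall j k, (N <= j)%N -> (N <= k)%N ->
      `|u j - u k| < e) ->
  exists l : R, u @ \oo --> l.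
Proof.
move=> uc; suff : cvg (u @ \oo) by move=> cu; exists (limn u).
apply: cauchy_cvg; apply: cauchy_exP => e /uc [N Nu].
by exists (u N); exists N => // k /= Nk; apply: Nu.
Qed.

Lemma Im_norm_le (x : Cx R) : real_complex R `|complex.Im x| <= `|x| :> Cx R.
Proof.
case: x => a b; change ((`|b|)%:C%C <= `|Complex a b|).
by rewrite normc_def lecR /= -[leLHS]sqrtr_sqr ler_wsqrtr // lerDr sqr_ge0.
Qed.

Lemma cx_pos (e : Cx R) : 0 < e -> exists2 r : R, 0 < r & e = real_complex R r.
Proof.
by case: e => a b; rewrite ltcE /= => /andP[/eqP -> a0]; exists a.
Qed.

(** Real and imaginary parts are bounded by the modulus, so both are Cauchy in [R]; [norm_cx_le]
    recombines the two limits. *)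
Lemma cauchy_cvg_cx (u : nat -> Cx R) :
    (forall e : Cx R, 0 < e -> exists N, forall j k, (N <= j)%N -> (N <= k)%N ->
      `|u j - u k| < e) ->
  exists l : Cx R, u @ \oo --> l.
Proof.
move=> uc.
have lt_of (x y : R) (z : Cx R) : real_complex R x <= z -> z < real_complex R y -> x < y.
  by move=> xz zy; rewrite -(ltcR x y); apply: le_lt_trans xz zy.
have [|a ua] := @cauchy_cvg_real (fun k => complex.Re (u k)).
  move=> e e0; have [|N Nu] := uc (real_complex R e); first by rewrite ltcR.
  exists N => j k Nj Nk; have := Nu _ _ Nj Nk; apply: lt_of.
  by rewrite -raddfB; apply: Re_norm_le.
have [|b ub] := @cauchy_cvg_real (fun k => complex.Im (u k)).
  move=> e e0; have [|N Nu] := uc (real_complex R e); first by rewrite ltcR.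
  exists N => j k Nj Nk; have := Nu _ _ Nj Nk; apply: lt_of.
  by rewrite -raddfB; apply: Im_norm_le.
exists (Complex a b : Cx R); apply/cvgn_dist => _ /cx_pos[e e0 ->].
have e20 : 0 < e / 2 by rewrite divr_gt0.
have [N1 Na] := (cvgn_dist _ _).1 ua (e / 2) e20.
have [N2 Nb] := (cvgn_dist _ _).1 ub (e / 2) e20.
exists (maxn N1 N2) => k; rewrite geq_max => /andP[/Na ka /Nb kb].
apply: le_lt_trans (norm_cx_le _) _; rewrite ltcR [e]splitr !raddfB /=.
exact: ltrD.
Qed.

End CxSequences.

(** * Cauchy sequences of polynomials for the weighted l1 norm *)

Section PolyApprox.
Variables (R : realType) (n : nat).
Notation C := (Cx R).
Implicit Types (p q : mpoly n C) (s t : C) (P Q : nat -> mpoly n C).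

Lemma le_mnorm s p q : 0 <= s ->
  (forall m, `|mcoeff m p| <= `|mcoeff m q|) -> mnorm s p <= mnorm s q.
Proof.
move=> s0 pq; rewrite [leLHS](@mnormE _ _ _ _ (msupp q)) ?msupp_uniq //.
  by apply: ler_sum => m _; rewrite ler_wpM2r ?exprn_ge0.
move=> m; rewrite !mcoeff_msupp; apply: contraNneq => qm.
by have := pq m; rewrite qm normr0 normr_le0.
Qed.

Lemma le_mnorm_radius s t p : 0 <= s -> s <= t -> mnorm s p <= mnorm t p.
Proof.
by move=> s0 st; apply: ler_sum => m _; rewrite ler_wpM2l // lerXn2r ?nnegrE // (le_trans s0).
Qed.

(** A Cauchy estimate. Differentiation brings down an exponent [m i <= mdeg m <= 2 ^ mdeg m], which
    doubling the radius absorbs. *)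
Lemma mnorm_deriv s p i : 0 < s -> mnorm s (mderiv i p) <= s^-1 * mnorm (2 * s) p.
Proof.
move=> s0; have s1 := ltW s0; rewrite {1}[p]mpolyE raddf_sum /=.
apply: le_trans (mnorm_sum _ _ _ s1) _; rewrite mulr_sumr; apply: ler_sum => m _.
rewrite mderivZ mderivX scalerA mnormZX normrM normr_nat mulrCA.
rewrite -mulrA ler_wpM2l // exprMn mulrCA.
(* Subtraction of exponents is truncated: the degree drops by one only when [m i] is positive, and
   otherwise the term is zero. *)
have [->|mi] := eqVneq (m i) 0%N; first by rewrite mul0r !mulr_ge0 ?exprn_ge0 ?invr_ge0.
have dm : mdeg m = (mdeg (mnm_sub m (mnm1 i))).+1.
  by rewrite -[in LHS](@submK _ (mnm1 i) m) ?lep1mP // mdegD mdeg1 addn1.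
rewrite [in X in _ <= _ * X]dm exprS mulKf ?gt_eqF //.
rewrite ler_wpM2r ?exprn_ge0 // -natrX ler_nat.
apply: leq_trans (ltnW (ltn_expl (mdeg m) (ltnSn 1))).
by rewrite mdegE (bigD1 i) //= leq_addr.
Qed.

Definition pcauchy s P := forall e : C, 0 < e -> exists N, forall j k,
  (N <= j)%N -> (N <= k)%N -> mnorm s (P j - P k) <= e.

Lemma pcauchy_radius s t P : 0 <= s -> s <= t -> pcauchy t P -> pcauchy s P.
Proof.
move=> s0 st cP e /cP[N HN]; exists N => j k Nj Nk.
exact: le_trans (le_mnorm_radius _ s0 st) (HN j k Nj Nk).
Qed.

Lemma pcauchy_bounded s P : 0 <= s -> pcauchy s P ->
  exists2 B, 0 < B & forall k, mnorm s (P k) <= B.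
Proof.
move=> s0 cP; have [N HN] := cP 1 ltr01.
pose B := 1 + mnorm s (P N) + \sum_(k < N) mnorm s (P k).
have S0 : 0 <= \sum_(k < N) mnorm s (P k) by apply: sumr_ge0 => k _; apply: mnorm_ge0.
exists B => [|k]; first by rewrite /B -addrA ltr_pwDl // addr_ge0 ?mnorm_ge0.
have [Nk|kN] := leqP N k.
  rewrite -[P k](subrK (P N)) -[leLHS]addr0; apply: lerD => //.
  by apply: le_trans (mnormD _ _ s0) _; rewrite lerD2r HN.
rewrite /B (bigD1 (Ordinal kN)) //= addrCA lerDl !addr_ge0 ?mnorm_ge0 //.
by apply: sumr_ge0 => j _; apply: mnorm_ge0.
Qed.

Lemma pcauchy_cst s p : pcauchy s (fun=> p).
Proof. by move=> e e0; exists 0%N => j k _ _; rewrite subrr mnorm0 ltW. Qed.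

Lemma pcauchyD s P Q : 0 <= s -> pcauchy s P -> pcauchy s Q ->
  pcauchy s (fun k => P k + Q k).
Proof.
move=> s0 cP cQ e e0; have e2 : 0 < e / 2 by rewrite divr_gt0.
have [N HN] := cP _ e2; have [M HM] := cQ _ e2.
exists (maxn N M) => j k; rewrite !geq_max => /andP[Nj Mj] /andP[Nk Mk].
rewrite [e]splitr opprD addrACA.
by apply: le_trans (mnormD _ _ s0) _; apply: lerD; [apply: HN|apply: HM].
Qed.

Lemma pcauchyM s P Q : 0 <= s -> pcauchy s P -> pcauchy s Q ->
  pcauchy s (fun k => P k * Q k).
Proof.
move=> s0 cP cQ e e0.
have [A A0 bA] := pcauchy_bounded s0 cP; have [B B0 bB] := pcauchy_bounded s0 cQ.
have eA : 0 < e / 2 / B by rewrite !divr_gt0.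
have eB : 0 < e / 2 / A by rewrite !divr_gt0.
have [N HN] := cP _ eA; have [M HM] := cQ _ eB.
exists (maxn N M) => j k; rewrite !geq_max => /andP[Nj Mj] /andP[Nk Mk].
have -> : P j * Q j - P k * Q k = (P j - P k) * Q j + P k * (Q j - Q k).
  by rewrite mulrBl mulrBr addrA subrK.
apply: le_trans (mnormD _ _ s0) _; rewrite [e]splitr; apply: lerD.
  apply: le_trans (mnormM _ _ s0) _; rewrite -[e / 2](divfK (lt0r_neq0 B0)).
  by apply: ler_pM; rewrite ?mnorm_ge0 ?HN.
apply: le_trans (mnormM _ _ s0) _; rewrite -[e / 2](divfK (lt0r_neq0 A0)) [leRHS]mulrC.
by apply: ler_pM; rewrite ?mnorm_ge0 ?HM.
Qed.

Lemma pcauchy_deriv s P i : 0 < s -> pcauchy (2 * s) P ->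
  pcauchy s (fun k => mderiv i (P k)).
Proof.
move=> s0 cP e e0; have [N HN] := cP _ (mulr_gt0 s0 e0).
exists N => j k Nj Nk; rewrite -mderivB; apply: le_trans (mnorm_deriv _ _ s0) _.
by rewrite ler_pdivrMl // HN.
Qed.

End PolyApprox.

(** * Taylor expansion along complex lines *)

Section LineTaylor.
Variables (R : realType) (n : nat).
Notation C := (Cx R).
Implicit Types (p : mpoly n C) (q : {poly C}) (P : nat -> mpoly n C).

Lemma cvgn_norm_le (u : nat -> C) (l B : C) :
  u @ \oo --> l -> (forall k, `|u k| <= B) -> `|l| <= B.
Proof.
move=> /cvgn_dist ul uB.
have B0 : 0 <= B by apply: le_trans (uB 0%N).
rewrite real_leNgt ?ger0_real //; apply/negP => Bl.
have [|N /(_ _ (leqnn N))] := ul (`|l| - B); first by rewrite subr_gt0.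
rewrite ltrBrDr => lN; have := ler_normD (l - u N) (u N).
rewrite subrK => lle; suff : `|l| < `|l| by rewrite ltxx.
by apply: le_lt_trans lle _; apply: le_lt_trans lN; rewrite lerD2l.
Qed.

Lemma poly_taylor_le q t J : `|t| <= 1 ->
  `|q.[t] - \sum_(j < J) q`_j * t ^+ j| <= pnorm q * `|t| ^+ J.
Proof.
(* Padding to [J + size q] terms lets the sum be cut after [J] of them even when [J] exceeds
   [size q]. *)
move=> t1; rewrite (@horner_coef_wide _ (J + size q)) ?leq_addl //.
rewrite big_split_ord /= addrAC subrr add0r.
rewrite (@pnormE _ q (J + size q)) ?leq_addl // big_split_ord /= mulrDl.
apply: le_trans (ler_norm_sum _ _ _) _.
rewrite -[leLHS]add0r; apply: lerD; first by rewrite mulr_ge0 ?exprn_ge0 ?sumr_ge0.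
rewrite mulr_suml; apply: ler_sum => j _; rewrite normrM normrX ler_wpM2l //.
by rewrite ler_wiXn2l // leq_addr.
Qed.

(** Each polynomial [P k] has this expansion with the same constant [B], and its coefficients on the
    line are Cauchy by [pnorm_line]; so the estimate passes to the limit. Continuity uses it with
    [J = 1], differentiability with [J = 2], the identity theorem with all [J]. *)
Lemma line_taylor s P B (b w : 'I_n -> C) (F : C -> C) :
    pcauchy s P -> (forall k, mnorm s (P k) <= B) ->
    (forall i, `|b i| + `|w i| <= s) ->
    (forall t, `|t| <= 1 -> (fun k => meval (fun i => b i + t * w i) (P k)) @ \oo --> F t) ->
  exists q : nat -> C,
    (forall j, (fun k => (line b w (P k))`_j) @ \oo --> q j) /\
    forall t J, `|t| <= 1 -> `|F t - \sum_(j < J) q j * t ^+ j| <= B * `|t| ^+ J.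
Proof.
move=> cP PB bws PF.
have qP j : exists l : C, (fun k => (line b w (P k))`_j) @ \oo --> l.
  apply: cauchy_cvg_cx => e e0; have e2 : 0 < e / 2 by rewrite divr_gt0.
  have [N HN] := cP _ e2; exists N => i k Ni Nk.
  rewrite -coefB -lineB; apply: le_lt_trans (coef_norm_le _ _) _.
  apply: le_lt_trans (pnorm_line _ bws) _; apply: le_lt_trans (HN _ _ Ni Nk) _.
  by rewrite [e in ltRHS]splitr ltrDl.
have [q qq] := choice qP; exists q; split=> // t J t1.
apply: (@cvgn_norm_le (fun k => (line b w (P k)).[t] - \sum_(j < J) (line b w (P k))`_j * t ^+ j)).
  apply: cvgB; first by under eq_fun do rewrite horner_line; apply: PF.
  apply: (cvg_big add_continuous) => j _; apply: cvgMr_tmp; exact: qq.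
move=> k; apply: le_trans (poly_taylor_le _ _ t1) _; rewrite ler_wpM2r ?exprn_ge0 //.
exact: le_trans (pnorm_line _ bws) _.
Qed.

End LineTaylor.

(** * Power series versus approximation by polynomials *)

Section HolomorphicApprox.
Variables (R : realType) (n : nat).
Notation C := (Cx R).
Implicit Types (p q : mpoly n C) (s t : C) (P Q : nat -> mpoly n C).
Implicit Types (c : multinom n -> C) (z a : 'rV[C]_n) (f g : fn R n).

Lemma half_expn_small (e B : C) : 0 < e -> 0 < B ->
  exists N, forall k, (N <= k)%N -> 2^-1 ^+ k * B < e.
Proof.
move=> /cx_pos[e' e0 ->] /cx_pos[b b0 ->].
have h1 : `|2^-1 : R| < 1 by rewrite ger0_norm ?invr_ge0 // invf_lt1 // ltr1n.
have [|N HN] := (cvgn_dist _ _).1 (cvg_expr h1) (e' / b); first by rewrite divr_gt0.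
exists N => k /HN; rewrite sub0r normrN ger0_norm ?exprn_ge0 ?invr_ge0 //.
rewrite ltr_pdivlMr // -(ltcR (_ * _)) rmorphM rmorphXn fmorphV rmorph_nat.
exact.
Qed.

Definition trunc c N : mpoly n C := \sum_(m : bmultinom n N) c (bmnm m) *: mpolyX C (bmnm m).

Lemma mcoeff_trunc c N m : mcoeff m (trunc c N) = if (mdeg m < N)%N then c m else 0.
Proof.
case: ltnP => mN; first by rewrite /trunc mcoeff_mpoly.
rewrite /trunc raddf_sum big1 // => m' _; rewrite /= mcoeffZ mcoeffX.
case: eqP => [mm|_]; last by rewrite mulr0.
by have := bmdeg m'; rewrite mm ltnNge mN.
Qed.

Lemma msize_trunc c N : (mmeasure mdeg (trunc c N) <= N)%N.
Proof.
rewrite msizeE big_seq; apply: (big_ind (fun x => x <= N)%N) => [//|x y xN yN|m].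
  by rewrite geq_max xN.
by rewrite mcoeff_msupp mcoeff_trunc; case: ltnP => //; rewrite eqxx.
Qed.

Lemma mnorm_wide s p N : (mmeasure mdeg p <= N)%N ->
  mnorm s p = \sum_(m : bmultinom n N) `|mcoeff (bmnm m) p| * s ^+ mdeg (bmnm m).
Proof.
move=> pN; rewrite -(big_image _ _ (@bmnm n N) predT (fun m => `|mcoeff m p| * s ^+ mdeg m)) /=.
apply: mnormE; first by rewrite map_inj_uniq ?enum_uniq //; apply: val_inj.
move=> m mp; have mN : (mdeg m < N)%N by apply: leq_trans (msize_mdeg_lt mp) pN.
by apply/mapP; exists (BMultinom mN); rewrite ?mem_enum.
Qed.

Lemma power_sumE c z N : power_sum c z N = meval (fun i => z 0 i) (trunc c N).
Proof.
rewrite /power_sum /trunc raddf_sum; apply: eq_bigr => m _.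
by rewrite /= mevalZ mevalX.
Qed.

Lemma normr_mmap1 z (m : multinom n) : `|mmap1 (fun i => z 0 i) m| = mmap1 (fun i => `|z 0 i|) m.
Proof. by rewrite /mmap1 normr_prod; apply: eq_bigr => i _; rewrite normrX. Qed.

Lemma mmap1_cst s (m : multinom n) : mmap1 (fun=> s) m = s ^+ mdeg m.
Proof. by rewrite /mmap1 mdegE expr_sum. Qed.

(** The point [z] is absorbed into the coefficients, which turns the radius into 1. *)
Lemma power_norm_sumE c z N :
  power_norm_sum c z N = mnorm 1 (trunc (fun m => c m * mmap1 (fun i => z 0 i) m) N).
Proof.
rewrite (mnorm_wide _ (msize_trunc _ _)); apply: eq_bigr => m _.
by rewrite expr1n mulr1 mcoeff_trunc bmdeg.
Qed.

(** The shorter truncation and the difference have disjoint supports, so their l1 norms add up. A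
    convergent series of norms therefore gives a Cauchy sequence of truncations. *)
Lemma mnorm_truncB c s j k : (k <= j)%N ->
  mnorm s (trunc c j - trunc c k) = mnorm s (trunc c j) - mnorm s (trunc c k).
Proof.
move=> kj; have szB : (mmeasure mdeg (trunc c j - trunc c k) <= j)%N.
  apply: leq_trans (msizeD_le _ _) _; rewrite msizeN geq_max msize_trunc /=.
  exact: leq_trans (msize_trunc _ _) kj.
rewrite (mnorm_wide _ szB) (mnorm_wide _ (msize_trunc _ _)).
rewrite (@mnorm_wide s (trunc c k) j) ?(leq_trans (msize_trunc _ _)) //.
rewrite -sumrB; apply: eq_bigr => m _; rewrite -mulrBl mcoeffB !mcoeff_trunc bmdeg.
by case: ltnP => _; rewrite ?subrr ?normr0 ?subrr // !subr0.
Qed.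

(* Holomorphy at [a] amounts to the existence of such an approximation by
   polynomials; unlike coefficients of power series, these can be multiplied and
   differentiated termwise. *)
Definition approx f a s P := [/\ 0 < s, pcauchy s P &
  forall z, (forall i, `|z 0 i| <= s) ->
    (fun k => meval (fun i => z 0 i) (P k)) @ \oo --> f (a + z)].

(** Absolute convergence at the single point with all coordinates [r / 2] controls the truncations
    on the whole closed polydisc of that radius. *)
Lemma holomorphic_approx f a : holomorphic_at f a -> exists s P, approx f a s P.
Proof.
move=> [r [c [r0 rc]]]; exists (r / 2), (trunc c).
have r2 : 0 < r / 2 by rewrite divr_gt0.
have rr : r / 2 < r by rewrite ltr_pdivrMr // ltr_pMr // ltr1n.
split=> // [e e0|z zr].
  have [|/cvg_ex[l /= /cvgn_dist ul] _] := rc (const_mx (r / 2)).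
    by move=> i; rewrite mxE ger0_norm // ltW.
  have e2 : 0 < e / 2 by rewrite divr_gt0.
  have [N HN] := ul _ e2; exists N => j k Nj Nk.
  have pnE i : power_norm_sum c (const_mx (r / 2)) i = mnorm (r / 2) (trunc c i).
    rewrite (mnorm_wide _ (msize_trunc _ _)); apply: eq_bigr => m _.
    rewrite normrM normr_mmap1 mcoeff_trunc bmdeg -mmap1_cst; congr (_ * _).
    by apply: mmap1_eq => i'; rewrite mxE ger0_norm // ltW.
  have le1 i i' : (N <= i)%N -> (N <= i')%N ->
      mnorm (r / 2) (trunc c i) - mnorm (r / 2) (trunc c i') <= e.
    move=> Ni Ni'; apply: le_trans (real_ler_norm _) _.
      by rewrite rpredB ?ger0_real ?mnorm_ge0 // ltW.
    rewrite -!pnE -(subrKA l) [e]splitr; apply: le_trans (ler_normD _ _) _.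
    by rewrite distrC lerD // ltW // HN.
  have [kj|/ltnW jk] := leqP k j; first by rewrite mnorm_truncB ?le1.
  by rewrite -mnormN opprB mnorm_truncB ?le1.
have [|_] := rc z; first by move=> i; apply: le_lt_trans (zr i) rr.
by rewrite (_ : power_sum c z = fun k => meval (fun i => z 0 i) (trunc c k)) //;
  apply/funext => k; rewrite power_sumE.
Qed.

(** The coefficients of [P k] converge because the norm bounds them; their limits are the power
    series. Halving the radius then makes all remainders geometric with ratio 1/2. *)
Lemma approx_holomorphic f a s P : approx f a s P -> holomorphic_at f a.
Proof.
move=> [s0 cP Pf]; have s1 := ltW s0.
have [B B0 PB] := pcauchy_bounded s1 cP.
have cE m : exists l : C, (fun k => mcoeff m (P k)) @ \oo --> l.
  apply: cauchy_cvg_cx => e e0.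
  have e2 : 0 < e / 2 * s ^+ mdeg m by rewrite mulr_gt0 ?exprn_gt0 ?divr_gt0.
  have [N HN] := cP _ e2; exists N => j k Nj Nk.
  rewrite -mcoeffB; have := HN j k Nj Nk.
  set p := P j - P k => le_p.
  apply: (@le_lt_trans _ _ (e / 2)); last by rewrite [e in ltRHS]splitr ltrDl divr_gt0.
  rewrite -(ler_pM2r (exprn_gt0 (mdeg m) s0)); apply: le_trans le_p.
  have [mp|/memN_msupp_eq0->] := boolP (m \in msupp p).
    rewrite /mnorm (big_rem m) //= lerDl; apply: sumr_ge0 => m' _.
    by rewrite mulr_ge0 ?exprn_ge0.
  by rewrite normr0 mul0r mnorm_ge0.
have [c cP'] := choice cE.
(* A truncation of the limit series is the limit of the truncations of the [P k], whose norms are at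
   most that of [P k]. *)
have cB N : mnorm s (trunc c N) <= B.
  rewrite -[leLHS]ger0_norm ?mnorm_ge0 // (mnorm_wide _ (msize_trunc _ _)).
  apply: (@cvgn_norm_le _ (fun k => \sum_(m : bmultinom n N)
      `|mcoeff (bmnm m) (P k)| * s ^+ mdeg (bmnm m))).
    apply: (cvg_big add_continuous) => m _; rewrite mcoeff_trunc bmdeg.
    by apply: cvgMr_tmp; apply: cvg_norm; apply: cP'.
  move=> k; rewrite ger0_norm ?sumr_ge0 // => [|m _]; last by rewrite mulr_ge0 ?exprn_ge0.
  apply: le_trans (PB k).
  have trk : mnorm s (trunc (fun m => mcoeff m (P k)) N) <= mnorm s (P k).
    by apply: le_mnorm => // m; rewrite mcoeff_trunc; case: ifP; rewrite ?normr0.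
  apply: le_trans trk; rewrite (mnorm_wide _ (msize_trunc _ _)).
  by apply: ler_sum => m _; rewrite mcoeff_trunc bmdeg.
pose t := s / 2; have t0 : 0 < t by rewrite divr_gt0.
have ts : t <= s by rewrite ler_pdivrMr // ler_pMr // ler1n.
have tsE : t / s = 2^-1 by rewrite /t mulrAC divff ?mul1r // lt0r_neq0.
exists t, c; split=> // z zt; have zt' i : `|z 0 i| <= t := ltW (zt i).
split.
  have [|l ul] := @cauchy_cvg_cx R (power_norm_sum c z); last by apply/cvg_ex; exists l.
  have small j k : (k <= j)%N ->
      `|power_norm_sum c z j - power_norm_sum c z k| <= 2^-1 ^+ k * B.
    move=> kj; rewrite !power_norm_sumE -mnorm_truncB // ger0_norm ?mnorm_ge0 //.
    apply: (@le_trans _ _ (mnorm t (trunc c j - trunc c k))).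
      have szB c' : (mmeasure mdeg (trunc c' j - trunc c' k) <= j)%N.
        apply: leq_trans (msizeD_le _ _) _; rewrite msizeN geq_max msize_trunc /=.
        exact: leq_trans (msize_trunc _ _) kj.
      rewrite !(mnorm_wide _ (szB _)); apply: ler_sum => m _.
      rewrite expr1n mulr1 !mcoeffB !mcoeff_trunc bmdeg.
      case: ltnP => _; first by rewrite !subrr normr0 mul0r.
      rewrite !subr0 normrM ler_wpM2l // normr_mmap1 -mmap1_cst.
      by apply: ler_prod => i _; rewrite exprn_ge0 //= lerXn2r ?nnegrE // ltW.
    apply: le_trans (@mnorm_order _ _ s t _ k (ltW t0) s0 ts _) _.
      move=> m; rewrite mcoeff_msupp mcoeffB !mcoeff_trunc; case: (ltnP (mdeg m) k) => // mk.
      by rewrite (leq_trans mk kj) subrr eqxx.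
    rewrite tsE ler_wpM2l ?exprn_ge0 ?invr_ge0 // mnorm_truncB //.
    by apply: le_trans (cB j); rewrite gerBl mnorm_ge0.
  move=> e e0; have [N HN] := half_expn_small e0 B0; exists N => j k Nj Nk.
  have [kj|/ltnW jk] := leqP k j; first exact: le_lt_trans (small _ _ kj) (HN _ Nk).
  by rewrite distrC; apply: le_lt_trans (small _ _ jk) (HN _ Nj).
(* Removing from [P k] its terms of degree less than [N] leaves a polynomial of order at least [N],
   to which [mnorm_order] applies uniformly in [k]. *)
have err N : `|f (a + z) - power_sum c z N| <= 2^-1 ^+ N * B.
  apply: (@cvgn_norm_le _ (fun k => meval (fun i => z 0 i) (P k) -
      \sum_(m : bmultinom n N) mcoeff (bmnm m) (P k) * mmap1 (fun i => z 0 i) (bmnm m))).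
    apply: cvgB; first by apply: Pf => i; apply: le_trans ts.
    apply: (cvg_big add_continuous) => m _; apply: cvgMr_tmp; exact: cP'.
  move=> k; pose T := trunc (fun m => mcoeff m (P k)) N.
  have -> : \sum_(m : bmultinom n N) mcoeff (bmnm m) (P k) * mmap1 (fun i => z 0 i) (bmnm m)
     = meval (fun i => z 0 i) T by rewrite -power_sumE.
  rewrite -mevalB; apply: le_trans (norm_meval_le _ zt') _.
  apply: le_trans (@mnorm_order _ _ s t _ N (ltW t0) s0 ts _) _.
    by move=> m; rewrite mcoeff_msupp mcoeffB mcoeff_trunc leqNgt; case: ltnP; rewrite ?subrr ?eqxx.
  rewrite tsE ler_wpM2l ?exprn_ge0 ?invr_ge0 //; apply: le_trans (PB k).
  apply: le_mnorm => // m; rewrite mcoeffB mcoeff_trunc.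
  by case: ifP; rewrite ?subrr ?normr0 // subr0.
apply/cvgn_dist => e e0; have [N HN] := half_expn_small e0 B0; exists N => k Nk.
exact: le_lt_trans (err k) (HN _ Nk).
Qed.

End HolomorphicApprox.

(** * Operations on holomorphic functions and their continuity *)

Section HolomorphicLocal.
Variables (R : realType) (n : nat).
Notation C := (Cx R).
Implicit Types (p q : mpoly n C) (s t : C) (P Q : nat -> mpoly n C).
Implicit Types (z a b w : 'rV[C]_n) (f g : fn R n).

Lemma approx_radius f a s t P : 0 < t -> t <= s -> approx f a s P -> approx f a t P.
Proof.
move=> t0 ts [s0 cP Pf]; split; [exact: t0|exact: pcauchy_radius (ltW t0) ts cP|].
by move=> z zt; apply: Pf => i; apply: le_trans ts.
Qed.

Lemma approx_common f g a s t P Q : approx f a s P -> approx g a t Q ->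
  exists2 r, approx f a r P & approx g a r Q.
Proof.
move=> fP gQ; have [s0 _ _] := fP; have [t0 _ _] := gQ.
(* [Cx R] is only partially ordered; this expression, smaller than both [s] and [t], stands in for
   their minimum. *)
have r0 : 0 < s * t / (s + t) by rewrite divr_gt0 ?mulr_gt0 ?addr_gt0.
exists (s * t / (s + t)).
  apply: approx_radius r0 _ fP.
  by rewrite ler_pdivrMr ?addr_gt0 // ler_wpM2l ?lerDr // ltW.
apply: approx_radius r0 _ gQ.
by rewrite ler_pdivrMr ?addr_gt0 // mulrC ler_wpM2l ?lerDl // ltW.
Qed.

Lemma holomorphicD f g a : holomorphic_at f a -> holomorphic_at g a ->
  holomorphic_at (f + g) a.
Proof.
move=> /holomorphic_approx[s [P fP]] /holomorphic_approx[t [Q gQ]].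
have [r [r0 cP Pf] [_ cQ Qg]] := approx_common fP gQ.
apply: (@approx_holomorphic _ _ _ _ r (fun k => P k + Q k)); split; [exact: r0| |].
  by apply: pcauchyD => //; apply: ltW.
move=> z zr; under eq_fun do rewrite mevalD.
by apply: cvgD; [apply: Pf|apply: Qg].
Qed.

Lemma holomorphicM f g a : holomorphic_at f a -> holomorphic_at g a ->
  holomorphic_at (f * g) a.
Proof.
move=> /holomorphic_approx[s [P fP]] /holomorphic_approx[t [Q gQ]].
have [r [r0 cP Pf] [_ cQ Qg]] := approx_common fP gQ.
apply: (@approx_holomorphic _ _ _ _ r (fun k => P k * Q k)); split; [exact: r0| |].
  by apply: pcauchyM => //; apply: ltW.
move=> z zr; under eq_fun do rewrite mevalM.
by apply: cvgM; [apply: Pf|apply: Qg].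
Qed.

Lemma holomorphic_cst (x : C) a : holomorphic_at (fun=> x : C) a.
Proof.
apply: (@approx_holomorphic _ _ _ _ 1 (fun=> mpolyC n x)); split; [exact: ltr01| |].
  exact: pcauchy_cst.
by move=> z _; under eq_fun do rewrite mevalC; apply: cvg_cst.
Qed.

Lemma holomorphicN f a : holomorphic_at f a -> holomorphic_at (- f) a.
Proof.
move=> fa; rewrite (_ : - f = (fun=> -1) * f); last first.
  by apply/funext => u; rewrite /= mulN1r.
exact: holomorphicM (holomorphic_cst _ _) fa.
Qed.

Lemma holomorphic_shift f v a : holomorphic_at f (a + v) ->
  holomorphic_at (fun u => f (u + v)) a.
Proof.
move=> [r [c [r0 rc]]]; exists r, c; split=> [|z zr]; first exact: r0.
rewrite addrAC; exact: rc.
Qed.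

Lemma approx_line f a s P : approx f a s P -> exists2 B, 0 < B & forall b w,
    (forall i, `|b 0 i| + `|w 0 i| <= s) ->
  exists q : nat -> C,
    (forall j, (fun k => (line (fun i => b 0 i) (fun i => w 0 i) (P k))`_j) @ \oo --> q j) /\
    forall t J, `|t| <= 1 ->
      `|f (a + b + t *: w) - \sum_(j < J) q j * t ^+ j| <= B * `|t| ^+ J.
Proof.
move=> [s0 cP Pf]; have [B B0 PB] := pcauchy_bounded (ltW s0) cP.
exists B => // b w bws; apply: (line_taylor cP PB bws) => t t1.
rewrite -addrA; have -> : (fun i => b 0 i + t * w 0 i) = (fun i => (b + t *: w) 0 i).
  by apply/funext => i; rewrite !mxE.
apply: Pf => i; rewrite !mxE; apply: le_trans (ler_normD _ _) _.
apply: le_trans (bws i); rewrite lerD2l normrM ler_piMl //.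
Qed.

Lemma ball_rV a (e : C) b : 0 < e -> ball a e b <-> forall i, `|a 0 i - b 0 i| < e.
Proof.
move=> e0; split=> [[_ h] i|h]; first exact: (h 0 i).
by split=> // i j; rewrite ord1; apply: h.
Qed.

Lemma holomorphic_continuous f a : holomorphic_at f a -> {for a, continuous f}.
Proof.
move=> /holomorphic_approx[s [P /[dup] fP [s0 _ _]]].
have [B B0 HB] := approx_line fP.
apply/(@cvgrPdist_lt _ _ _ _ (nbhs_filter a)) => e e0; apply/nbhs_ballP.
(* This gives [t <= 1] and [B * t < e]. A point [x] within [t * s] of [a] is reached at parameter
   [t] in the direction [t^-1 *: (x - a)], whose coordinates are at most [s]. *)
pose t := e / (B + B + e); have den0 : 0 < B + B + e by rewrite !addr_gt0.
have t0 : 0 < t by rewrite divr_gt0.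
have t1 : t <= 1 by rewrite ler_pdivrMr // mul1r lerDr addr_ge0 // ltW.
exists (t * s) => /=; first by rewrite mulr_gt0.
move=> x /(ball_rV _ _ (mulr_gt0 t0 s0)) ax; have [|q [_ Hq]] := HB 0 (t^-1 *: (x - a)).
  move=> i; rewrite !mxE normr0 add0r normrM normfV (gtr0_norm t0).
  by rewrite ler_pdivrMl // distrC ltW.
have q0 : f a = q 0%N.
  apply/eqP; rewrite -subr_eq0 -normr_le0.
  have := Hq 0 1%N; rewrite normr0 scale0r big_ord1 expr0 mulr1 !addr0 expr1 mulr0.
  by apply; rewrite ler01.
have := Hq t 1%N; rewrite gtr0_norm // => /(_ t1).
rewrite big_ord1 expr0 mulr1 addr0 scalerA divff ?lt0r_neq0 // scale1r [a + _]addrC subrK.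
rewrite -q0 distrC expr1 => /le_lt_trans; apply.
by rewrite mulrCA -[ltRHS]mulr1 ltr_pM2l // ltr_pdivrMr // mul1r -addrA ltrDl addr_gt0.
Qed.

Lemma is_derive_quad (f : fn R n) a v (d K r : C) : 0 < r -> 0 < K ->
    (forall h, `|h| <= r -> `|f (a + h *: v) - f a - h * d| <= K * `|h| ^+ 2) ->
  is_derive a v f d.
Proof.
move=> r0 K0 Hf.
have alg (h x : C) : h != 0 -> d - h^-1 * x = - h^-1 * (x - h * d).
  by move=> h0; rewrite mulrBr !mulNr opprK mulKf // addrC.
have lim_d : h^-1 *: ((f \o shift a) (h *: v) - f a) @[h --> (0 : C)^'] --> d.
  apply/cvgrPdist_lt => e e0; rewrite near_withinE; apply/nbhs_ballP.
  have den0 : 0 < r * K + e by rewrite addr_gt0 ?mulr_gt0.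
  (* This radius is below [r], where the estimate holds, and below [e / K], where the quadratic term
     is small enough. *)
  exists (r * e / (r * K + e)) => /=; first by rewrite divr_gt0 ?mulr_gt0.
  move=> h; rewrite /ball /= sub0r normrN => hr h0.
  have hr' : `|h| <= r.
    apply: ltW; apply: lt_le_trans hr _.
    by rewrite ler_pdivrMr // ler_wpM2l ?lerDr ?mulr_ge0 // ltW.
  have hn0 : 0 < `|h| by rewrite normr_gt0.
  have -> : d - h^-1 *: (f (h *: v + a) - f a) = - h^-1 * (f (a + h *: v) - f a - h * d).
    by rewrite [a + _]addrC; apply: alg.
  rewrite mulNr normrN normrM normfV ltr_pdivrMl //.
  apply: le_lt_trans (Hf _ hr') _; rewrite expr2 mulrCA ltr_pM2l //.
  rewrite -(ltr_pM2l r0); move: hr; rewrite ltr_pdivlMr //; apply: le_lt_trans.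
  by rewrite mulrDr (mulrC `|h| (_ * _)) mulrA lerDl mulr_ge0 // ltW.
by apply: DeriveDef; [apply/cvg_ex; exists d|apply: cvg_lim].
Qed.

End HolomorphicLocal.

(** * Partial derivatives and the local identity theorem *)

Section HolomorphicDerive.
Variables (R : realType) (n : nat).
Notation C := (Cx R).
Implicit Types (p q : mpoly n C) (s t : C) (P Q : nat -> mpoly n C).
Implicit Types (z a b w : 'rV[C]_n) (f g : fn R n).

Lemma exists_lower_bound (e u : C) : 0 < e -> 0 < u ->
  exists t : C, [/\ 0 < t, t <= e & t <= u].
Proof.
move=> e0 u0; have eu0 : 0 < e + u by rewrite addr_gt0.
exists (e * u / (e + u)); split; first by rewrite divr_gt0 ?mulr_gt0.
  by rewrite ler_pdivrMr // ler_wpM2l ?lerDr // ltW.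
by rewrite ler_pdivrMr // mulrC ler_wpM2l ?lerDl // ltW.
Qed.

(** From a point of the half polydisc the step [s / 2] in direction [i] stays in the polydisc. The
    expansion to order 2 on that line gives the derivative, and its linear coefficient is the limit
    of those of the [P k], that is, of their partial derivatives. *)
Lemma approx_derive f a s P i z : approx f a s P -> (forall j, `|z 0 j| <= s / 2) ->
  exists2 d, is_derive (a + z) (delta_mx 0 i) f d &
    (fun k => meval (fun j => z 0 j) (mderiv i (P k))) @ \oo --> d.
Proof.
move=> /[dup] fP [s0 _ _] zs; have [B B0 HB] := approx_line fP.
have h0 : 0 < s / 2 by rewrite divr_gt0.
have hn0 := lt0r_neq0 h0.
have [|q [qlim Hq]] := HB z (s / 2 *: delta_mx 0 i).
  move=> j; rewrite !mxE eqxx /= [s in leRHS]splitr lerD //.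
  by case: (j == i); rewrite ?mulr1 ?mulr0 ?normr0 ?gtr0_norm // ltW.
have q0 : f (a + z) = q 0%N.
  apply/eqP; rewrite -subr_eq0 -normr_le0.
  have := Hq 0 1%N; rewrite normr0 scale0r big_ord1 expr0 mulr1 !addr0 expr1 mulr0.
  by apply; rewrite ler01.
exists (q 1%N / (s / 2)).
  apply: (@is_derive_quad _ _ _ _ _ _ (B / (s / 2) ^+ 2) (s / 2)) => //.
    by rewrite divr_gt0 ?exprn_gt0.
  move=> h hs; have := Hq (h / (s / 2)) 2%N.
  rewrite big_ord_recr big_ord1 /= expr0 mulr1 expr1 -q0 scalerA divfK //.
  rewrite normrM normfV (gtr0_norm h0) ler_pdivrMr // mul1r => /(_ hs).
  rewrite opprD addrA mulrCA expr_div_n mulrA mulrAC => le.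
  by rewrite -[B / _ * _]mulrA [_^-1 * _]mulrC.
have -> : (fun k => meval (fun j => z 0 j) (mderiv i (P k))) =
   fun k => (line (fun j => z 0 j) (fun j => (s / 2 *: delta_mx 0 i : 'rV[C]_n) 0 j)
     (P k))`_1 / (s / 2).
  apply/funext => k; rewrite coef1_line (bigD1 i) //= big1 => [|j ji].
    by rewrite !mxE !eqxx mulr1 addr0 mulfK.
  by rewrite !mxE (negbTE ji) andbF !mulr0.
by apply: cvgMr_tmp; apply: qlim.
Qed.

Lemma holomorphic_partial f a i : holomorphic_at f a -> holomorphic_at (partial i f) a.
Proof.
move=> /holomorphic_approx[s [P /[dup] fP [s0 cP _]]].
have h0 : 0 < s / 2 by rewrite divr_gt0.
apply: (@approx_holomorphic _ _ _ _ (s / 2) (fun k => mderiv i (P k))).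
split; [exact: h0| |].
  have sE : 2 * (s / 2) = s by rewrite mulrC divfK ?pnatr_eq0.
  by apply: pcauchy_deriv h0 _; rewrite sE.
move=> z zs; have [d [_ dE]] := approx_derive i fP zs.
by rewrite /partial dE.
Qed.

Lemma holomorphic_derivable f a i : holomorphic_at f a -> derivable f a (delta_mx 0 i).
Proof.
move=> /holomorphic_approx[s [P /[dup] fP [s0 _ _]]].
have [|d [df _] _] := @approx_derive f a s P i 0 fP.
  by move=> j; rewrite mxE normr0 divr_ge0 // ltW.
by rewrite addr0 in df.
Qed.

(** On the line from [b] in direction [2 *: (z - b)] the point [z] has parameter 1/2. All Taylor
    coefficients vanish, so the value at [z] is at most [2^-1 ^+ J * B] for every [J]. The radius
    [s / 8] leaves room for the doubled direction, of size at most [s / 2]. *)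
Lemma approx_eq0 f a s P b z : approx f a s P ->
    (forall i, `|b 0 i| <= s / 8) -> (forall i, `|z 0 i| <= s / 8) ->
    (\forall x \near a + b, f x = 0) ->
  f (a + z) = 0.
Proof.
move=> /[dup] fP [s0 _ _] bs zs /nbhs_ballP[e /= e0 fe]; have [B B0 HB] := approx_line fP.
have ws i : `|(2 *: (z - b)) 0 i| <= s / 2.
  rewrite !mxE normrM normr_nat; apply: (@le_trans _ _ (2 * (s / 8 + s / 8))).
    by rewrite ler_wpM2l //; apply: le_trans (ler_normB _ _) _; apply: lerD.
  by rewrite [leLHS](_ : _ = s / 2) //; field.
have [|q [_ Hq]] := HB b (2 *: (z - b)).
  move=> i; rewrite [s in leRHS]splitr; apply: lerD (ws i).
  by apply: le_trans (bs i) _; rewrite ler_wpM2l ?ltW // ltf_pV2 ?posrE ?ltr_nat.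
(* With [d <= e / s] a parameter of modulus at most [d] moves the point by at most [e / 2], inside
   the ball where [f] vanishes. *)
have [d [d0 d1 ds]] := exists_lower_bound ltr01 (divr_gt0 e0 s0).
have fd t : `|t| <= d -> f (a + b + t *: (2 *: (z - b))) = 0.
  move=> td; apply: fe; apply/(ball_rV _ _ e0) => i; rewrite !mxE opprD addrA subrr sub0r normrN.
  have wi := ws i; rewrite !mxE in wi.
  rewrite normrM; apply: le_lt_trans (ler_pM (normr_ge0 _) (normr_ge0 _) td wi) _.
  move: ds; rewrite ler_pdivlMr // => ds.
  apply: (@le_lt_trans _ _ (e / 2)); first by rewrite mulrA ler_pM2r ?invr_gt0.
  by rewrite [e in ltRHS]splitr ltrDl divr_gt0.
have qE j : q j = 0.
  elim/ltn_ind: j => j IH; apply/eqP; apply: contraT; rewrite -normr_gt0 => qj.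
  (* Since [f] and the earlier coefficients vanish, the remainder forces [|q j| <= B * t]; the
     choice [t <= |q j| / (2 B)] contradicts this. *)
  have [t [t0 td tq]] := exists_lower_bound d0 (divr_gt0 qj (addr_gt0 B0 B0)).
  have tn : `|t| = t by rewrite gtr0_norm.
  have := Hq t j.+1; rewrite tn (le_trans td d1) fd ?tn // => /(_ isT).
  rewrite big_ord_recr /= big1 => [|i _]; last by rewrite IH ?mul0r.
  rewrite !add0r normrN normrM normrX tn exprS mulrA ler_pM2r ?exprn_gt0 // => qB.
  move: tq; rewrite ler_pdivlMr ?addr_gt0 // mulrDr ![t * B]mulrC => tq.
  have := le_trans (lerD qB qB) tq; rewrite gerDl => q_le0.
  by have := lt_le_trans qj q_le0; rewrite ltxx.
have two0 : 2 != 0 :> C by rewrite pnatr_eq0.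
have fz J : `|f (a + z)| <= 2^-1 ^+ J * B.
  have := Hq 2^-1 J; rewrite big1 => [|i _]; last by rewrite qE mul0r.
  rewrite subr0 scalerA (mulVf two0) scale1r -addrA [b + _]addrC subrK.
  by rewrite gtr0_norm ?invr_gt0 // [B * _]mulrC; apply; rewrite invf_le1 ?ler1n.
apply/eqP; apply: contraT; rewrite -normr_gt0 => f0.
have [N /(_ N (leqnn _))] := half_expn_small f0 B0.
by move=> /(le_lt_trans (fz N)); rewrite ltxx.
Qed.

End HolomorphicDerive.

(** * Meromorphic functions and the identity theorem *)

Section Generic.
Variable T : topologicalType.
Implicit Types (P Q : T -> Prop) (O : set T).

(** A local criterion with no global witness: conversely, the interior of the set where [P] holds
    serves as dense open set. *)
Lemma genericallyP P : generically P <->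
  forall O, open O -> O !=set0 ->
    exists V : set T, [/\ open V, V !=set0, V `<=` O & forall x, V x -> P x].
Proof.
split=> [[W [oW dW WP]] O oO O0|H].
  exists (O `&` W); split; [exact: openI|exact: dW|by move=> x []|].
  by move=> x [_ /WP].
exists (interior [set x | P x]); split; first exact: open_interior.
  move=> O O0 oO; have [V [oV [x Vx] VO VP]] := H O oO O0.
  exists x; split; first exact: VO.
  by apply: (filterS VP); apply: open_nbhs_nbhs.
by move=> x /interior_subset.
Qed.

Lemma generically_true P : (forall x, P x) -> generically P.
Proof.
move=> HP; exists setT; split=> //; first exact: openT.
by move=> O O0 _; rewrite setIT.
Qed.

Lemma generically_imp P Q : (forall x, P x -> Q x) -> generically P -> generically Q.
Proof. by move=> PQ [W [oW dW WP]]; exists W; split=> // x /WP /PQ. Qed.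

Lemma generically_and P Q : generically P -> generically Q ->
  generically (fun x => P x /\ Q x).
Proof.
move=> [V [oV dV VP]] [W [oW dW WQ]]; exists (V `&` W).
split; [exact: openI|exact: denseI|by move=> x [/VP Px /WQ Qx]; split].
Qed.

Lemma generically_imp2 P Q (S : T -> Prop) : (forall x, P x -> Q x -> S x) ->
  generically P -> generically Q -> generically S.
Proof.
move=> H gP gQ; apply: generically_imp (generically_and gP gQ) => x [Px Qx].
exact: H.
Qed.

Lemma generically_all (I : finType) (P : I -> T -> Prop) :
  (forall i, generically (P i)) -> generically (fun x => forall i, P i x).
Proof.
move=> HP; suff : generically (fun x => forall i, i \in enum I -> P i x).
  by apply: generically_imp => x H i; apply: H; rewrite mem_enum.
elim: (enum I) => [|i s IH]; first by apply: generically_true.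
apply: generically_imp2 (HP i) IH => x Pi Ps j; rewrite inE => /predU1P[->//|].
exact: Ps.
Qed.

Lemma generically_near P x O : generically P -> open O -> O x ->
  exists y, [/\ O y, P y & \forall z \near y, P z].
Proof.
move=> /genericallyP H oO Ox; have [|V [oV [y Vy] VO VP]] := H O oO; first by exists x.
exists y; split; [exact: VO|exact: VP|].
by apply: (filterS VP); apply: open_nbhs_nbhs.
Qed.

Lemma generically_locally P :
  (forall x, exists V : set T, [/\ open V, V x & generically (fun y => V y -> P y)]) ->
  generically P.
Proof.
move=> H; apply/genericallyP => O oO [x Ox].
have [V [oV Vx /genericallyP gV]] := H x.
have [|W [oW [y Wy] WOV WP]] := gV (O `&` V) (openI oO oV); first by exists x.
exists W; split=> //; [by exists y|by move=> z /WOV[]|].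
by move=> z Wz; apply: (WP z Wz); case: (WOV z Wz).
Qed.

End Generic.

Lemma shift_continuous (K : numFieldType) (V : normedModType K) (w : V) :
  continuous (fun u : V => u + w).
Proof. by move=> u; apply: cvgD; [exact: cvg_id|exact: cvg_cst]. Qed.

Section Eqm.
Variables (R : realType) (n : nat).
Notation C := (Cx R).
Implicit Types f g h : fn R n.

Lemma eqm_refl f : f =m f.
Proof. exact: generically_true. Qed.

Lemma eqm_sym f g : f =m g -> g =m f.
Proof. exact: generically_imp. Qed.

Lemma eqm_trans g f h : f =m g -> g =m h -> f =m h.
Proof. by apply: generically_imp2 => u -> ->. Qed.

Lemma eqmD f f' g g' : f =m f' -> g =m g' -> f + g =m f' + g'.
Proof. by apply: generically_imp2 => u /= fu gu; rewrite /= /GRing.add /= fu gu. Qed.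

Lemma eqmM f f' g g' : f =m f' -> g =m g' -> f * g =m f' * g'.
Proof. by apply: generically_imp2 => u /= fu gu; rewrite /= /GRing.mul /= fu gu. Qed.

Lemma eqmV f f' : f =m f' -> (fun u => (f u)^-1) =m (fun u => (f' u)^-1).
Proof. by apply: generically_imp => u /= ->. Qed.

Lemma generically_shift (P : 'rV[C]_n -> Prop) (v : 'rV[C]_n) :
  generically P -> generically (fun u : 'rV[C]_n => P (u + v)).
Proof.
move=> [W [oW dW WP]]; exists ((fun u : 'rV[C]_n => u + v) @^-1` W); split.
- by apply: open_comp => // u _; apply: shift_continuous.
- move=> O [x Ox] oO; have [||y [Oy Wy]] := dW ((fun u : 'rV[C]_n => u - v) @^-1` O).
  + by exists (x + v); rewrite /preimage /= addrK.
  + by apply: open_comp => // u _; apply: shift_continuous.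
  by exists (y - v); split=> //=; rewrite /preimage /= subrK.
by move=> u /WP.
Qed.

End Eqm.

Lemma derive_div (K : numFieldType) (V : normedModType K) (g h : V -> K) (a v : V) :
    derivable g a v -> derivable h a v -> h a != 0 ->
  derivable (fun x => g x / h x) a v /\
  'D_v (fun x => g x / h x) a = ('D_v g a * h a - g a * 'D_v h a) / (h a * h a).
Proof.
move=> dg dh h0; have dV := derivableV h0 dh.
split; first exact: (@derivableM _ _ g (fun x => (h x)^-1)).
rewrite (@deriveM _ _ g (fun x => (h x)^-1)) // deriveV // /GRing.scale /=.
by field.
Qed.

Lemma near_eq_continuous (T U : topologicalType) (f g : T -> U) (a : T) :
  (\forall x \near a, f x = g x) -> {for a, continuous g} -> {for a, continuous f}.
Proof.
move=> fg cg A; rewrite (nbhs_singleton fg) => /cg gA.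
by apply: filterS2 fg gA => x; rewrite /preimage /= => ->.
Qed.

(** * Regular points of meromorphic functions *)

Section Regular.
Variables (R : realType) (n : nat).
Notation C := (Cx R).
Implicit Types (f g h : fn R n) (a z : 'rV[C]_n).

(* Contrary to [meromorphic], no exceptional set: the quotient gives the values
   of [f] at all points near [a]. *)
Definition regular f a := exists (U : set 'rV[C]_n) (g h : fn R n),
  [/\ open U, U a & forall z, U z ->
    [/\ holomorphic_at g z, holomorphic_at h z, h z != 0 & f z = g z / h z]].

Lemma regular_open f : open [set a | regular f a].
Proof.
rewrite openE => a [U [g [h [oU Ua H]]]].
apply: (@filterS _ (nbhs a) _ U); last exact: open_nbhs_nbhs.
by move=> z Uz; exists U, g, h; split.
Qed.

(** Intersecting the chart [U] with the dense open set [W] removes all exceptional points from it,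
    so the points left are regular. *)
Lemma meromorphic_regular f : meromorphic f -> generically (regular f).
Proof.
move=> mf; apply: generically_locally => a.
have [U [g [h [oU Ua gh [W [oW dW WP]]]]]] := mf a.
exists U; split=> //; apply: generically_imp (_ : generically W); last by exists W.
move=> z Wz Uz; exists (U `&` W), g, h; split; [exact: openI|by split|].
by move=> y [Uy Wy]; have [gy hy] := gh _ Uy; have [h0 fy] := WP _ Wy Uy; split.
Qed.

Lemma regular_continuous f a : regular f a -> {for a, continuous f}.
Proof.
move=> [U [g [h [oU Ua H]]]]; have [ga ha h0 fa] := H _ Ua.
have cgh : {for a, continuous (fun z => g z / h z)}.
  apply: (@continuousM _ _ g (fun z => (h z)^-1)); first exact: holomorphic_continuous.
  by apply: continuousV => //; apply: holomorphic_continuous.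
apply: near_eq_continuous cgh; apply: (@filterS _ (nbhs a) _ U); last exact: open_nbhs_nbhs.
by move=> z Uz; have [_ _ _ ->] := H _ Uz.
Qed.

Lemma regular_near f a : regular f a -> exists (g h : fn R n),
  [/\ holomorphic_at g a, holomorphic_at h a, h a != 0 &
      \forall z \near a, f z = g z / h z].
Proof.
move=> [U [g [h [oU Ua H]]]]; have [ga ha h0 fa] := H _ Ua.
exists g, h; split => //; apply: (@filterS _ (nbhs a) _ U); last exact: open_nbhs_nbhs.
by move=> z Uz; have [_ _ _ ->] := H _ Uz.
Qed.

Lemma regular_derivable f a p : regular f a -> derivable f a (delta_mx 0 p).
Proof.
move=> /regular_near[g [h [ga ha h0 fgh]]].
have [|||d _] := @derive_div _ _ g h a (delta_mx 0 p); [exact: holomorphic_derivable..|exact: h0|].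
by apply: near_eq_derivable d; apply: filterS fgh => z ->.
Qed.

End Regular.

Lemma line_continuous (K : numFieldType) (V : normedModType K) (a w : V) :
  continuous (fun k : K => a + k *: w).
Proof.
move=> k; under eq_fun do rewrite addrC.
exact: continuous_comp (@scalel_continuous K V w k) (@shift_continuous K V a (k *: w)).
Qed.

Lemma real_complex_continuous (R : realType) :
  continuous (fun x : R => real_complex R x : Cx R).
Proof.
move=> x; apply/cvgrPdist_lt => _ /cx_pos[e e0 ->]; near=> y.
rewrite -raddfB /= normc_def /= expr0n addr0 sqrtr_sqr ltcR.
near: y; exact: cvgr_dist_lt.
Unshelve. all: by end_near. Qed.

Lemma segment_continuous (R : realType) (V : normedModType (Cx R)) (a w : V) :
  continuous (fun t : R => a + (real_complex R t : Cx R) *: w).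
Proof.
move=> t; exact: (@continuous_comp _ _ _ (fun t : R => real_complex R t : Cx R)
  (fun k => a + k *: w) t (@real_complex_continuous R t) (@line_continuous _ _ a w _)).
Qed.

Section Meromorphic.
Variables (R : realType) (n : nat).
Notation C := (Cx R).
Implicit Types (f g h : fn R n) (a z : 'rV[C]_n).

Lemma meromorphic_eqm f g : f =m g -> meromorphic f -> meromorphic g.
Proof.
move=> fg mf a; have [U [g1 [h1 [oU Ua gh gen]]]] := mf a.
exists U, g1, h1; split; [exact: oU|exact: Ua|exact: gh|].
apply: generically_imp2 fg gen => z fgz H Uz; have [h0 E] := H Uz.
by split=> //; rewrite -E.
Qed.

Lemma meromorphic_cst (c : C) : meromorphic ((fun=> c) : fn R n).
Proof.
move=> a; exists setT, (fun=> c), (fun=> 1); split; [exact: openT|by []| |].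
  by move=> z _; split; apply: holomorphic_cst.
by apply: generically_true => z _; rewrite oner_neq0 divr1.
Qed.

Lemma meromorphicD f g : meromorphic f -> meromorphic g -> meromorphic (f + g).
Proof.
move=> mf mg a; have [U [f1 [f2 [oU Ua Hf gf]]]] := mf a.
have [V [g1 [g2 [oV Va Hg gg]]]] := mg a.
exists (U `&` V), (f1 * g2 + g1 * f2), (f2 * g2).
split; [exact: openI|by split| |].
  move=> z [/Hf[h1 h2] /Hg[h3 h4]]; split; last exact: holomorphicM.
  by apply: holomorphicD; apply: holomorphicM.
apply: generically_imp2 gf gg => z Ez Fz [Uz Vz].
have [f0 Ef] := Ez Uz; have [g0 Eg] := Fz Vz.
by rewrite !(addrfctE, mulrfctE) mulf_neq0 // Ef Eg addf_div.
Qed.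

Lemma meromorphicM f g : meromorphic f -> meromorphic g -> meromorphic (f * g).
Proof.
move=> mf mg a; have [U [f1 [f2 [oU Ua Hf gf]]]] := mf a.
have [V [g1 [g2 [oV Va Hg gg]]]] := mg a.
exists (U `&` V), (f1 * g1), (f2 * g2).
split; [exact: openI|by split| |].
  by move=> z [/Hf[h1 h2] /Hg[h3 h4]]; split; apply: holomorphicM.
apply: generically_imp2 gf gg => z Ez Fz [Uz Vz].
have [f0 Ef] := Ez Uz; have [g0 Eg] := Fz Vz.
by rewrite !mulrfctE mulf_neq0 // Ef Eg mulf_div.
Qed.

Lemma meromorphicN f : meromorphic f -> meromorphic (- f).
Proof.
move=> mf; rewrite (_ : - f = (fun=> -1) * f); last first.
  by apply/funext => u; rewrite /= mulN1r.
exact: meromorphicM (meromorphic_cst _) mf.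
Qed.

Lemma meromorphicB f g : meromorphic f -> meromorphic g -> meromorphic (f - g).
Proof. by move=> mf mg; apply: meromorphicD mf (meromorphicN mg). Qed.

Lemma meromorphic_shift f v : meromorphic f -> meromorphic (fun u => f (u + v)).
Proof.
move=> mf a; have [U [g [h [oU Ua gh gen]]]] := mf (a + v).
exists ((fun u : 'rV[C]_n => u + v) @^-1` U), (fun u => g (u + v)), (fun u => h (u + v)).
split.
- by apply: open_comp => // u _; apply: shift_continuous.
- exact: Ua.
- by move=> z /gh[gz hz]; split; apply: holomorphic_shift.
exact: generically_shift gen.
Qed.

(** The set [W] is open, so around each of its points in [U] the function equals [g / h] on a full
    neighbourhood and the quotient rule gives its derivative. *)
Lemma meromorphic_partial f p : meromorphic f -> meromorphic (partial p f).
Proof.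
move=> mf a; have [U [g [h [oU Ua gh [W [oW dW WP]]]]]] := mf a.
exists U, (partial p g * h - g * partial p h), (h * h); split; [exact: oU|exact: Ua| |].
  move=> z /gh[gz hz]; split; last exact: holomorphicM.
  apply: holomorphicD; first exact: holomorphicM (holomorphic_partial _ gz) hz.
  by apply: holomorphicN; apply: holomorphicM gz (holomorphic_partial _ hz).
apply: (@generically_imp _ W); last by exists W.
move=> z Wz Uz; have [gz hz] := gh _ Uz; have [h0 _] := WP _ Wz Uz.
split; first by rewrite mulf_neq0.
have [|||_ D] := @derive_div _ _ g h z (delta_mx 0 p);
  [exact: holomorphic_derivable..|exact: h0|].
rewrite /partial -[RHS]D; apply: near_eq_derive.
apply: (@filterS _ (nbhs z) _ (U `&` W)); last by apply: open_nbhs_nbhs; split; [exact: openI|].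
by move=> y [Uy Wy]; have [_ ->] := WP _ Wy Uy.
Qed.

Definition locally0 f : set 'rV[C]_n := [set a | exists V : set 'rV[C]_n,
  [/\ open V, V a & generically (fun z => V z -> f z = 0)]].

Lemma locally0_open f : open (locally0 f).
Proof.
rewrite openE => a [V [oV Va gV]]; apply: (@filterS _ (nbhs a) _ V).
  by move=> z Vz; exists V.
exact: open_nbhs_nbhs.
Qed.

(** At a limit point [a], write [f] as [g / h]. The numerator vanishes near some point close to [a],
    and its expansion at [a] carries this to a full neighbourhood by [approx_eq0]. *)
Lemma locally0_closed f : meromorphic f -> closed (locally0 f).
Proof.
move=> mf a cla; have [U [g [h [oU Ua gh gen]]]] := mf a.
have [ga _] := gh _ Ua; have [s [P /[dup] gP [s0 _ _]]] := holomorphic_approx ga.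
have s8 : 0 < s / 8 by rewrite divr_gt0.
have [/= e e0 eU] := (nbhs_ballP a U).1 (open_nbhs_nbhs (conj oU Ua)).
have [d [d0 de ds]] := exists_lower_bound e0 s8.
pose N := interior (ball a d).
have Na : N a by apply/nbhs_ballP; exists d.
have Nball z : N z -> forall i, `|(z - a) 0 i| <= s / 8.
  move=> /interior_subset /(ball_rV _ _ d0) az i; rewrite !mxE distrC.
  exact: le_trans (ltW (az i)) ds.
have NU : N `<=` U by move=> z /interior_subset zd; apply: eU; apply: le_ball de _ zd.
have [b [[V [oV Vb gV]] Nb]] : locally0 f `&` N !=set0.
  by apply: cla; apply: open_nbhs_nbhs; split => //; apply: open_interior.
have genb : generically (fun z => V z -> N z -> g z = 0).
  apply: generically_imp2 gen gV => z Ez Fz Vz Nz.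
  have [h0 E] := Ez (NU _ Nz); move: (Fz Vz) => /eqP.
  by rewrite E mulf_eq0 invr_eq0 (negbTE h0) orbF => /eqP.
have [b' [[Vb' Nb'] _ gb']] := generically_near genb
  (openI oV (open_interior (ball a d))) (conj Vb Nb : (V `&` N) b).
have near_b' : \forall z \near b', g z = 0.
  apply: filterS2 gb' (open_nbhs_nbhs (conj (openI oV (open_interior (ball a d))) (conj Vb' Nb'))).
  by move=> z H [Vz Nz]; apply: H.
have gN z : N z -> g z = 0.
  have gKE y : a + (y - a) = y by rewrite addrC subrK.
  move=> Nz; rewrite -(gKE z); apply: (approx_eq0 gP (Nball _ Nb') (Nball _ Nz)).
  by rewrite gKE.
exists N; split; [exact: open_interior|exact: Na|].
by apply: generically_imp gen => z Ez Nz; have [_ ->] := Ez (NU _ Nz); rewrite gN ?mul0r.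
Qed.

(* The points near which [f] vanishes generically form a clopen set, hence
   contain every real segment issued from one of them. *)
Lemma meromorphic_identity f : meromorphic f -> locally0 f !=set0 -> f =m 0.
Proof.
move=> mf [a fa]; suff H b : locally0 f b.
  by apply: generically_locally => b; have [V ?] := H b; exists V.
pose path (t : R) : 'rV[C]_n := a + (real_complex R t : C) *: (b - a).
have cpath : continuous path by exact: segment_continuous.
have cR : connected [set: R] by apply/connected_intervalP.
have : path @^-1` locally0 f = [set: R].
  apply: cR.
  - by exists 0; rewrite /preimage /= /path rmorph0 scale0r addr0.
  - exists (path @^-1` locally0 f); last by rewrite setTI.
    exact: (open_comp (fun t _ => cpath t) (@locally0_open f)).
  - exists (path @^-1` locally0 f); last by rewrite setTI.
    exact: (preimage_closed (fun t _ => cpath t) (locally0_closed mf)).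
move=> /(congr1 (fun S => S 1)) /=; rewrite /preimage /= /path rmorph1 scale1r.
by rewrite addrC subrK => ->.
Qed.

End Meromorphic.

(** * The field of meromorphic functions *)

Section MeromorphicField.
Variables (R : realType) (n : nat).
Notation C := (Cx R).
Implicit Types (f g h : fn R n) (a z : 'rV[C]_n).

Lemma generically_ex (P : 'rV[C]_n -> Prop) : generically P -> exists u, P u.
Proof.
move=> [W [oW dW WP]]; have [|u [_ /WP]] := dW setT _ openT; first by exists 0.
by exists u.
Qed.

(** If [f] vanished at all regular points of some open set, the identity theorem would give
    [f =m 0]. Otherwise continuity at a regular point spreads the nonzero value. This makes the
    classes modulo [=m] a field. *)
Lemma meromorphic_neq0 f : meromorphic f -> ~ f =m 0 ->
  generically (fun u => f u != 0).
Proof.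
move=> mf f0; apply/genericallyP => O oO [y Oy].
have [a [Oa ra _]] := generically_near (meromorphic_regular mf) oO Oy.
have oO' : open (O `&` regular f) by exact: (openI oO (@regular_open R n f)).
have [x [Ox rx] fx] : exists2 x, (O `&` regular f) x & f x != 0.
  apply: contrapT => H; apply: f0; apply: meromorphic_identity => //.
  exists a, (O `&` regular f); split; [exact: oO'|by []|].
  apply: generically_true => z Oz; apply/eqP; apply: contrapT => /negP fz.
  by apply: H; exists z.
have nz : \forall z \near x, f z != 0.
  have := regular_continuous rx => /(_ [set c | c != 0]); apply.
  apply/nbhs_ballP; exists `|f x| => /= [|c]; first by rewrite normr_gt0.
  by rewrite /ball /=; apply: contraTneq => ->; rewrite subr0 ltxx.
exists (interior (O `&` [set z | f z != 0])); split.
- exact: open_interior.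
- by exists x; apply: filterI nz; apply: open_nbhs_nbhs.
- by move=> z /interior_subset[].
- by move=> z /interior_subset[].
Qed.

Lemma meromorphicV f : meromorphic f -> meromorphic (fun u => (f u)^-1).
Proof.
(* By the convention that the inverse of 0 is 0, the inverse of a null function is null; in the
   other case numerator and denominator are exchanged. *)
move=> mf; have [f0|/(meromorphic_neq0 mf) f0] := pselect (f =m 0).
  apply: (@meromorphic_eqm _ _ (fun=> 0)); last exact: meromorphic_cst.
  by apply: generically_imp f0 => u ->; rewrite invr0.
move=> a; have [U [g [h [oU Ua gh gen]]]] := mf a.
exists U, h, g; split; [exact: oU|exact: Ua|by move=> z /gh[]|].
apply: generically_imp2 f0 gen => z fz E Uz; have [h0 Ef] := E Uz.
rewrite Ef invf_div; split=> //; apply: contraNneq fz => gz.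
by rewrite Ef gz mul0r.
Qed.

End MeromorphicField.

(** * The quotient of the ring of meromorphic functions by the null ideal *)

Section MeromorphicFieldType.
Variables (R : realType) (n : nat).
Notation C := (Cx R).

Definition mero_pred : {pred fn R n} := fun f => `[< meromorphic f >].

Fact mero_subring : subring_closed mero_pred.
Proof.
split=> [|f g /asboolP mf /asboolP mg|f g /asboolP mf /asboolP mg]; apply/asboolP.
- exact: meromorphic_cst.
- exact: meromorphicB.
- exact: meromorphicM.
Qed.

HB.instance Definition _ := GRing.isSubringClosed.Build (fn R n) mero_pred mero_subring.

Record mero := Mero {mero_fun : fn R n; _ : mero_fun \in mero_pred}.
HB.instance Definition _ := [isSub for mero_fun].
HB.instance Definition _ := [Choice of mero by <:].
HB.instance Definition _ := [SubChoice_isSubComNzRing of mero by <:].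

Definition null_pred : {pred mero} := fun f => `[< mero_fun f =m 0 >].

Fact null_idealr : idealr_closed null_pred.
Proof.
split=> [||a u v /asboolP u0 /asboolP v0].
- by apply/asboolP; apply: eqm_refl.
- apply/asboolP => /generically_ex[u /eqP]; apply/negP; exact: oner_neq0.
apply/asboolP; change (mero_fun a * mero_fun u + mero_fun v =m 0).
apply: (@eqm_trans _ _ (mero_fun a * 0 + 0)); last by rewrite mulr0 addr0; apply: eqm_refl.
exact: eqmD (eqmM (eqm_refl _) u0) v0.
Qed.
HB.instance Definition _ := isIdealr.Build mero null_pred null_idealr.

Definition merofield := {ideal_quot null_pred}.
HB.instance Definition _ := GRing.ComNzRing.on merofield.

End MeromorphicFieldType.

Section MeromorphicClass.
Variables (R : realType) (n : nat).
Notation C := (Cx R).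
Notation MF := (merofield R n).
Implicit Types (f g h : fn R n).

Local Open Scope quotient_scope.

Definition mcl f : MF :=
  if insub f is Some m then \pi_({ideal_quot @null_pred R n}) (m : mero R n) else 0.

Lemma mclE f (mf : f \in @mero_pred R n) : mcl f = \pi_({ideal_quot @null_pred R n}) (Mero mf).
Proof.
rewrite /mcl; case: insubP => [m _ mE|]; last by rewrite mf.
by congr (\pi_ _ _); apply: val_inj; rewrite mE.
Qed.

Lemma mcl_eqP f g : meromorphic f -> meromorphic g -> mcl f = mcl g <-> f =m g.
Proof.
move=> /asboolP mf /asboolP mg; rewrite (mclE mf) (mclE mg).
have E : (\pi_({ideal_quot @null_pred R n}) (Mero mf) ==
          \pi_({ideal_quot @null_pred R n}) (Mero mg)) = `[< f - g =m 0 >].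
  by rewrite -Quotient.idealrBE.
split.
  move=> /eqP; rewrite E => /asboolP.
  by apply: generically_imp => u /eqP; rewrite subr_eq0 => /eqP.
move=> fg; apply/eqP; rewrite E; apply/asboolP.
by apply: generically_imp fg => u fu; apply/eqP; rewrite subr_eq0; apply/eqP.
Qed.

Lemma mcl_surj (x : MF) : exists2 f, meromorphic f & x = mcl f.
Proof.
pose m := repr x; have mf := valP m; exists (mero_fun m); first exact/asboolP.
rewrite (mclE mf) -[LHS]reprK; congr (\pi_ _ _); exact: val_inj.
Qed.

Lemma mclD f g : meromorphic f -> meromorphic g -> mcl (f + g) = mcl f + mcl g.
Proof.
move=> Hf Hg; have /asboolP mf := Hf; have /asboolP mg := Hg.
have /asboolP mfg := meromorphicD Hf Hg.
rewrite (mclE mf) (mclE mg) (mclE mfg) -rmorphD; congr (\pi_ _ _); exact: val_inj.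
Qed.

Lemma mclM f g : meromorphic f -> meromorphic g -> mcl (f * g) = mcl f * mcl g.
Proof.
move=> Hf Hg; have /asboolP mf := Hf; have /asboolP mg := Hg.
have /asboolP mfg := meromorphicM Hf Hg.
rewrite (mclE mf) (mclE mg) (mclE mfg) -rmorphM; congr (\pi_ _ _); exact: val_inj.
Qed.

Lemma mcl1 : mcl 1 = 1.
Proof.
have /asboolP m1 := @meromorphic_cst R n 1.
rewrite (mclE m1) -[RHS](rmorph1 \pi_({ideal_quot @null_pred R n})).
congr (\pi_ _ _); exact: val_inj.
Qed.

Lemma mcl0 : mcl 0 = 0.
Proof.
have m0 := @meromorphic_cst R n 0; apply: (addrI (mcl 0)).
by rewrite -(mclD m0 m0) !addr0.
Qed.

Lemma mcl_eq0 f : meromorphic f -> mcl f = 0 <-> f =m 0.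
Proof. by move=> mf; rewrite -mcl0; apply: mcl_eqP => //; apply: meromorphic_cst. Qed.

Definition minv (x : MF) : MF := mcl (fun u => (mero_fun (repr x) u)^-1).

Lemma minvE f : meromorphic f -> minv (mcl f) = mcl (fun u => (f u)^-1).
Proof.
move=> mf; rewrite /minv; set m := repr _.
have mm : meromorphic (mero_fun m) by apply/asboolP; apply: valP m.
apply/mcl_eqP; [exact: meromorphicV mm|exact: meromorphicV mf|].
apply: eqmV; apply/mcl_eqP => //.
have /asboolP mp := mm; rewrite (mclE mp) -[RHS]reprK; congr (\pi_ _ _); exact: val_inj.
Qed.

Fact mero_mulVf (x : MF) : x != 0 -> minv x * x = 1.
Proof.
have [f mf ->] := mcl_surj x => /eqP f0; rewrite minvE // -mcl1.
have mV := meromorphicV mf; rewrite -mclM //.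
apply/mcl_eqP; [exact: meromorphicM|exact: meromorphic_cst|].
have f1 : ~ f =m 0 by move=> H; apply: f0; apply/mcl_eq0.
by apply: generically_imp (meromorphic_neq0 mf f1) => u fu; rewrite mulrfctE mulVf.
Qed.

Fact mero_inv0 : minv 0 = 0.
Proof.
have m0 := @meromorphic_cst R n 0.
rewrite -mcl0 minvE //; congr mcl; apply/funext => u; exact: invr0.
Qed.

HB.instance Definition _ := GRing.ComNzRing_isField.Build MF mero_mulVf mero_inv0.

End MeromorphicClass.

(* [cl] exhibits [MF] as the field of meromorphic functions modulo [=m]; its
   value is irrelevant on functions that are not meromorphic. *)
Record mero_class (R : realType) (n : nat) (MF : fieldType) (cl : fn R n -> MF) : Prop :=
  MeroClass {
  cl_eqP : forall f g, meromorphic f -> meromorphic g -> cl f = cl g <-> f =m g;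
  clD : forall f g, meromorphic f -> meromorphic g -> cl (f + g) = cl f + cl g;
  clM : forall f g, meromorphic f -> meromorphic g -> cl (f * g) = cl f * cl g;
  cl1 : cl 1 = 1 }.

(** This seals the quotient construction: what follows relies only on the four laws of
    [mero_class]. *)
Lemma mero_class_exists (R : realType) (n : nat) :
  exists (MF : fieldType) (cl : fn R n -> MF), mero_class cl.
Proof.
exists (merofield R n), (@mcl R n); split; [exact: mcl_eqP|exact: mclD|exact: mclM|exact: mcl1].
Qed.

(** * Compatibility of classes with constants, polynomials and sums *)

Section Evaluation.
Variables (R : realType) (n : nat).
Notation C := (Cx R).
Variables (MF : fieldType) (cl : fn R n -> MF) (clQ : mero_class cl).
Implicit Types f g : fn R n.

Let clE := cl_eqP clQ.
Let clD := clD clQ.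
Let clM := clM clQ.
Let cl1 := cl1 clQ.

Lemma cl0 : cl 0 = 0.
Proof.
have m0 := @meromorphic_cst R n 0; apply: (addrI (cl 0)).
by rewrite -(clD m0 m0) !addr0.
Qed.

Lemma cl_eq0 f : meromorphic f -> cl f = 0 <-> f =m 0.
Proof. by move=> mf; rewrite -cl0; apply: clE => //; apply: meromorphic_cst. Qed.

Lemma clN f : meromorphic f -> cl (- f) = - cl f.
Proof.
move=> mf; apply: (addrI (cl f)).
by rewrite -(clD mf (meromorphicN mf)) !subrr cl0.
Qed.

Lemma clB f g : meromorphic f -> meromorphic g -> cl (f - g) = cl f - cl g.
Proof. by move=> mf mg; rewrite (clD mf (meromorphicN mg)) clN. Qed.

Lemma clV f : meromorphic f -> cl (fun u => (f u)^-1) = (cl f)^-1.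
Proof.
move=> mf; have mV := meromorphicV mf.
have [f0|f0] := pselect (f =m 0).
  have -> : cl f = 0 by apply/cl_eq0.
  rewrite invr0; apply/(cl_eq0 mV); apply: generically_imp f0 => u ->; exact: invr0.
have cf0 : cl f != 0 by apply/eqP => /(cl_eq0 mf).
apply: (mulIf cf0); rewrite mulVf // -clM // -cl1.
apply/clE; [exact: meromorphicM|exact: meromorphic_cst|].
by apply: generically_imp (meromorphic_neq0 mf f0) => u fu; rewrite mulrfctE mulVf.
Qed.

(** The proof is made an argument so that the morphism instances, which depend on it, can be
    attached to this constant. *)
Definition clc of mero_class cl := fun c : C => cl (fun=> c).

Fact clc_zmod : zmod_morphism (clc clQ).
Proof.
move=> x y; rewrite /clc; have mx := @meromorphic_cst R n x.
have my := @meromorphic_cst R n y.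
by rewrite -clN // -clD //; apply: meromorphicN.
Qed.
HB.instance Definition _ := GRing.isZmodMorphism.Build C MF (clc clQ) clc_zmod.

Fact clc_monoid : monoid_morphism (clc clQ).
Proof.
split=> [|x y]; first exact: cl1.
by rewrite /clc -clM //; apply: meromorphic_cst.
Qed.
HB.instance Definition _ := GRing.isMonoidMorphism.Build C MF (clc clQ) clc_monoid.

Lemma meval_cl m (h : 'I_m -> fn R n) (P : mpoly m C) :
    (forall i, meromorphic (h i)) ->
  meromorphic (fun u => meval (fun i => h i u) P) /\
  cl (fun u => meval (fun i => h i u) P) = mmap (clc clQ) (fun i => cl (h i)) P.
Proof.
move=> mh; elim/mpoly_ring_ind: P => [c|i|P Q [mP EP] [mQ EQ]|P Q [mP EP] [mQ EQ]].
- rewrite (_ : (fun u => _) = fun=> c); last by apply/funext => u; rewrite mevalC.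
  by rewrite mmapC; split; [apply: meromorphic_cst|].
- rewrite (_ : (fun u => _) = h i); last by apply/funext => u; rewrite mevalXU.
  by rewrite mmapX mmap1U; split.
- set f := fun u => _; set g := fun u => _ in mP EP *; rewrite mmapD -EP -EQ.
  rewrite (_ : f = g + (fun u => meval (fun i => h i u) Q)); last first.
    by apply/funext => u; rewrite /f mevalD.
  by split; [apply: meromorphicD|rewrite clD].
set f := fun u => _; set g := fun u => _ in mP EP *; rewrite rmorphM /= -EP -EQ.
rewrite (_ : f = g * (fun u => meval (fun i => h i u) Q)); last first.
  by apply/funext => u; rewrite /f mevalM.
by split; [apply: meromorphicM|rewrite clM].
Qed.

Lemma cl_sum (I : Type) (r : seq I) (F : I -> fn R n) :
    (forall i, meromorphic (F i)) ->
  meromorphic (\sum_(i <- r) F i) /\ cl (\sum_(i <- r) F i) = \sum_(i <- r) cl (F i).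
Proof.
move=> mF; elim: r => [|i r [mr Er]].
  by rewrite !big_nil cl0; split; [apply: meromorphic_cst|].
by rewrite !big_cons -Er -clD //; split; [apply: meromorphicD|].
Qed.

Lemma cl_exp (f : fn R n) k : meromorphic f -> meromorphic (f ^+ k) /\ cl (f ^+ k) = cl f ^+ k.
Proof.
move=> mf; elim: k => [|k [mk Ek]].
  by rewrite !expr0 cl1; split; [apply: meromorphic_cst|].
by rewrite !exprS -Ek -clM //; split; [apply: meromorphicM|].
Qed.

(** The value is written as an explicit sum because [cl] respects sums and products on meromorphic
    functions only. *)
Lemma cl_horner (p : {poly fn R n}) (f : fn R n) :
    (forall i, meromorphic p`_i) -> meromorphic f ->
  meromorphic p.[f] /\ cl p.[f] = \sum_(i < size p) cl p`_i * cl f ^+ i.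
Proof.
move=> mp mf; have mt i : meromorphic (p`_i * f ^+ i).
  by apply: meromorphicM => //; case: (cl_exp i mf).
rewrite horner_coef; have [] := cl_sum (index_enum 'I_(size p)) (fun i => mt (nat_of_ord i)).
move=> ms ->; split=> //; apply: eq_bigr => i _.
by have [me <-] := cl_exp i mf; rewrite clM.
Qed.

Lemma meromorphic_subfield : subfield [set f : fn R n | meromorphic f].
Proof.
split=> //=; first exact: meromorphic_eqm.
- exact: meromorphic_cst.
- by move=> f g mf mg; split; [apply: meromorphicB|apply: meromorphicM].
- exact: meromorphicV.
Qed.

(** All meromorphic functions form one of the subfields whose intersection is [adjoin K S]. *)
Lemma adjoin_meromorphic (K S : set (fn R n)) f :
    (forall g, K g -> meromorphic g) -> (forall g, S g -> meromorphic g) ->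
  adjoin K S f -> meromorphic f.
Proof. by move=> mK mS; apply; [exact: meromorphic_subfield|..]. Qed.

Lemma adjoin_subfield (K S : set (fn R n)) :
    (forall g, K g -> meromorphic g) -> (forall g, S g -> meromorphic g) ->
  subfield (adjoin K S).
Proof.
move=> mK mS; split.
- by move=> f; apply: adjoin_meromorphic.
- move=> f g fg af L /[dup] sL [mL eL oL bL vL] KL SL.
  exact: (eL _ _ fg (af L sL KL SL)).
- by move=> L [mL eL oL bL vL] KL SL.
- move=> f g af ag; split=> L /[dup] sL [mL eL oL bL vL] KL SL.
    by case: (bL f g (af L sL KL SL) (ag L sL KL SL)).
  by case: (bL f g (af L sL KL SL) (ag L sL KL SL)).
- move=> f af L /[dup] sL [mL eL oL bL vL] KL SL.
  exact: (vL _ (af L sL KL SL)).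
Qed.

End Evaluation.

(** * Algebraic extensions and primitive elements *)

Section SubfieldOf.
Variables (L : fieldType) (S : {pred L}).

(** Tagging [S] with its closure proof gives a key for the closure instance, from which the subset
    becomes a field type. *)
Definition divring_pred of divring_closed S : {pred L} := S.

Variable dS : divring_closed S.

HB.instance Definition _ := GRing.isDivringClosed.Build L (divring_pred dS) dS.

Record subfield_of := SubfieldOf {sfval : L; _ : sfval \in divring_pred dS}.
HB.instance Definition _ := [isSub for sfval].
HB.instance Definition _ := [Choice of subfield_of by <:].
HB.instance Definition _ := [SubChoice_isSubIntegralDomain of subfield_of by <:].
HB.instance Definition _ := [SubIntegralDomain_isSubField of subfield_of by <:].

End SubfieldOf.

Section AlgebraicElements.
Variables (L : fieldType) (S : {pred L}) (dS : divring_closed S).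
Implicit Types x y : L.

Definition algebraic_elt x := exists2 p : {poly L}, p != 0 & (forall i, p`_i \in S) /\ root p x.

Let F := subfield_of dS.
Let iota : {rmorphism F -> L} := (\val : F -> L).

Let map_polyOver (q : {poly F}) : forall i, (map_poly iota q)`_i \in S.
Proof. by move=> i; rewrite coef_map; apply: (valP q`_i). Qed.

Let polyOver_map (p : {poly L}) : (forall i, p`_i \in S) ->
  exists q : {poly F}, p = map_poly iota q.
Proof.
move=> pS; exists (\poly_(i < size p) SubfieldOf (pS i : _ \in divring_pred dS)).
apply/polyP => i; rewrite coef_map coef_poly.
by case: ltnP => // pi; rewrite nth_default // rmorph0.
Qed.

(** Reduces algebraicity over a subset to algebraicity over an embedded field, whose closure
    properties and primitive element theorem then apply. *)
Lemma algebraic_eltP x : algebraic_elt x <-> algebraicOver iota x.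
Proof.
split=> [[p p0 [/polyOver_map[q pq] px]]|[q q0 qx]].
  by exists q; rewrite -?pq //; apply: contraNneq p0 => q0; rewrite pq q0 rmorph0.
by exists (map_poly iota q); [rewrite map_poly_eq0|split].
Qed.

Lemma algebraic_elt_divring : divring_closed (fun x => `[< algebraic_elt x >]).
Proof.
split=> [|x y /asboolP/algebraic_eltP ax /asboolP/algebraic_eltP ay|
          x y /asboolP/algebraic_eltP ax /asboolP/algebraic_eltP ay];
  apply/asboolP/algebraic_eltP.
- exact: algebraic1.
- exact: algebraic_sub.
- exact: algebraic_div.
Qed.

Lemma algebraic_elt_id x : x \in S -> algebraic_elt x.
Proof.
move=> xS; apply/algebraic_eltP.
by have := algebraic_id iota (SubfieldOf (xS : _ \in divring_pred dS)).
Qed.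

(** Induction on the list: the primitive element theorem in characteristic 0 replaces [y] and [x i]
    by [y *+ k - x i] for some natural number [k]. Only integer multiples occur, so the coefficients
    stay in any subring [A]. *)
Lemma algebraic_primitive (I : eqType) (r : seq I) (x : I -> L) (A : {pred L}) :
    [pchar L] =i pred0 -> uniq r -> (forall i, i \in r -> algebraic_elt (x i)) ->
    subring_closed A -> {subset A <= S} ->
  exists2 a : I -> L, (forall i, a i \in A) & forall i, i \in r ->
    exists2 q : {poly L}, (forall l, q`_l \in S) & q.[\sum_(j <- r) a j * x j] = x i.
Proof.
move=> chL + + clA AS; have [A1 AB AM] := clA.
have A0 : 0 \in A by rewrite -(subrr 1) AB.
have AN a : a \in A -> - a \in A by rewrite -(sub0r a); apply: AB.
have chF : [pchar F] =i pred0 by move=> p; rewrite -chL; apply/esym/(fmorph_pchar iota).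
elim: r => [_ _|i r IH /= /andP[ir ur] ax]; first by exists (fun=> 1).
have [|a aA aq] := IH ur; first by move=> j jr; apply: ax; rewrite inE jr orbT.
set y := \sum_(j <- r) _ in aq.
have [u u0 ui] : algebraicOver iota (x i) by apply/algebraic_eltP/ax/mem_head.
have [v v0 vy] : algebraicOver iota y.
  have := ax; rewrite /y; elim: (r) => [_|j s IHs axs].
    by rewrite big_nil; apply: algebraic0.
  rewrite big_cons; apply: algebraic_add.
    apply: algebraic_mul; first by apply/algebraic_eltP/algebraic_elt_id/AS/aA.
    by apply/algebraic_eltP/axs; rewrite !inE eqxx orbT.
  by apply: IHs => k; rewrite inE => /predU1P[->|ks]; apply: axs; rewrite !inE ?eqxx ?ks ?orbT.
have [k [[q qx] [q' qy]]] := separable.pchar0_PET u0 ui v0 vy chF.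
exists (fun j => if j == i then - 1 else a j * k%:R) => [j|j].
  case: ifP => _; first exact: AN.
  apply: AM; first exact: aA.
  by elim: k {qx qy} => [//|k kA]; rewrite -addn1 natrD -[1%:R]opprK AB ?AN.
have -> : \sum_(l <- i :: r) (if l == i then -1 else a l * k%:R) * x l = y *+ k - x i.
  rewrite big_cons eqxx mulN1r addrC; congr (_ - _).
  rewrite -[y *+ k]mulr_natr mulr_suml big_seq [RHS]big_seq; apply: eq_bigr => l lr.
  by case: eqP => [li|_]; [rewrite -li lr in ir|rewrite mulrAC].
rewrite inE => /predU1P[->|jr]; first by exists (map_poly iota q).
have [qj qjS qjx] := aq _ jr; have [q1 qjE] := polyOver_map qjS.
(* The older [x j] is a polynomial in [y], which is itself a polynomial in the new element. *)
exists (map_poly iota (q1 \Po q')) => //.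
by rewrite map_comp_poly horner_comp qy -qjE.
Qed.

End AlgebraicElements.

(** * Subfields of functions seen in the field of classes *)

Section SubfieldClass.
Variables (R : realType) (n : nat).
Notation C := (Cx R).
Variables (MF : fieldType) (cl : fn R n -> MF) (clQ : mero_class cl).
Implicit Types (K L S : set (fn R n)) (f g : fn R n).

Let clE := cl_eqP clQ.
Let clM := clM clQ.
Let cl1 := cl1 clQ.
Let clB := clB clQ.
Let clV := clV clQ.
Let cl0 := cl0 clQ.
Let cl_eq0 := cl_eq0 clQ.

Definition clset K : {pred MF} := fun x => `[< exists2 f, K f & x = cl f >].

Lemma clsetP K f : subfield K -> meromorphic f -> reflect (K f) (cl f \in clset K).
Proof.
move=> [mK eK _ _ _] mf; apply: (iffP (asboolP _)) => [[g Kg E]|Kf]; last by exists f.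
exact: (eK _ _ (eqm_sym ((clE mf (mK _ Kg)).1 E)) Kg).
Qed.

Lemma clset_divring K : subfield K -> divring_closed (clset K).
Proof.
move=> [mK eK oK bK vK].
split=> [|x y /asboolP[f Kf ->] /asboolP[g Kg ->]|x y /asboolP[f Kf ->] /asboolP[g Kg ->]];
  apply/asboolP.
- by exists 1 => //; rewrite cl1.
- exists (f - g); first by case: (bK _ _ Kf Kg).
  by rewrite clB //; apply: mK.
exists (f * (fun u => (g u)^-1)); first by case: (bK _ _ Kf (vK _ Kg)).
by rewrite clM ?clV //; [apply: mK|apply: mK|apply: meromorphicV; apply: mK].
Qed.

Lemma merofield_char0 : [pchar MF] =i pred0.
Proof.
move=> p; rewrite !inE; apply/negP => /andP[pp].
rewrite -(rmorph_nat (clc clQ)) fmorph_eq0 pnatr_eq0 => /eqP p0.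
by rewrite p0 in pp.
Qed.

(** Taken as a competitor [L] in the definition of [adjoin], this field shows that adjoining
    algebraic functions gives only algebraic ones. *)
Lemma algebraic_subfield K : subfield K ->
  subfield [set f | meromorphic f /\ algebraic_elt (clset K) (cl f)].
Proof.
move=> sK; have [a1 aB aV] := algebraic_elt_divring (clset_divring sK).
split=> [f [] //|f g fg [mf af]|||f [mf af]].
- have mg := meromorphic_eqm fg mf.
  by split=> //; rewrite -((clE mf mg).2 fg).
- by split; [apply: meromorphic_cst|rewrite cl1; apply/asboolP].
- move=> f g [mf af] [mg ag]; do !split.
  + exact: meromorphicB.
  + rewrite clB //.
    by apply/asboolP/aB; apply/asboolP.
  + exact: meromorphicM.
  rewrite clM // -[cl g]invrK; apply/asboolP/aV; apply/asboolP => //.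
  by rewrite -[_^-1]mul1r; apply/asboolP/aV; [exact: a1|apply/asboolP].
split; [exact: meromorphicV|rewrite clV // -[_^-1]mul1r].
by apply/asboolP/aV; [exact: a1|apply/asboolP].
Qed.

(** Size and monicity over functions refer to literal equality, finer than [=m]. Hence the
    coefficients 0 and 1 are lifted to the functions 0 and 1 themselves. *)
Lemma cl_poly_lift K (p : {poly MF}) : subfield K -> (forall i, p`_i \in clset K) -> p \is monic ->
  exists P : {poly fn R n}, [/\ poly_over K P, P \is monic &
    forall f, meromorphic f -> meromorphic P.[f] /\ cl P.[f] = p.[cl f]].
Proof.
move=> /[dup] sK [mK eK oK bK vK] pK /monicP pm.
have H i : exists f, [/\ K f, cl f = p`_i, p`_i = 0 -> f = 0 & p`_i = 1 -> f = 1].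
  have [p1|p1] := eqVneq p`_i 1.
    exists 1; split=> //; first by rewrite cl1.
    by rewrite p1 => /eqP; rewrite oner_eq0.
  have [p0|p0] := eqVneq p`_i 0.
    exists 0; split=> //; first by rewrite -(subrr 1); case: (bK _ _ oK oK).
      by rewrite cl0.
    by rewrite p0 => /esym/eqP; rewrite oner_eq0.
  have /asboolP[f Kf E] := pK i.
  by exists f; split=> // E'; rewrite E' eqxx in p0 p1.
have [c cP] := choice H.
pose P : {poly fn R n} := \poly_(i < size p) c i.
have Pc i : P`_i = c i.
  rewrite coef_poly; case: ltnP => // pi; have [_ _ c0 _] := cP i.
  by rewrite c0 // nth_default.
have p0 : p != 0 by rewrite -lead_coef_eq0 pm oner_eq0.
have sP : size P = size p.
  apply: size_poly_eq; have [_ _ _ c1] := cP (size p).-1.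
  by rewrite c1 ?oner_neq0.
exists P; split.
- by move=> i; rewrite Pc; case: (cP i).
- by apply/monicP; rewrite lead_coefE sP Pc; have [_ _ _ ->] := cP (size p).-1.
move=> f mf; have [] := @cl_horner _ _ _ _ clQ P f _ mf.
  by move=> i; rewrite Pc; apply: mK; case: (cP i).
move=> mP ->; split=> //; rewrite sP horner_coef; apply: eq_bigr => i _.
by rewrite Pc; have [_ -> _ _] := cP i.
Qed.

Lemma algebraic_elt_monic K f : subfield K -> meromorphic f ->
    algebraic_elt (clset K) (cl f) ->
  exists P : {poly fn R n}, [/\ poly_over K P, P \is monic & P.[f] =m 0].
Proof.
move=> sK mf [p p0 [pK /rootP pf]].
have [K1 KB KV] := clset_divring sK.
have qm : (lead_coef p)^-1 *: p \is monic.
  by apply/monicP; rewrite lead_coefZ mulVf ?lead_coef_eq0.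
have [|P [PK Pm /(_ f mf)[mP EP]]] := @cl_poly_lift K _ sK _ qm.
  by move=> i; rewrite coefZ mulrC; apply: KV; apply: pK.
by exists P; split=> //; apply/(cl_eq0 mP); rewrite EP hornerZ pf mulr0.
Qed.

Lemma monic_algebraic_over K f (P : {poly fn R n}) :
  poly_over K P -> P \is monic -> P.[f] =m 0 -> algebraic_over K f.
Proof.
move=> PK /monicP Pm Pf; exists P; split=> //; exists (size P).-1.
rewrite -lead_coefE Pm => /generically_ex[u /eqP]; apply/negP; exact: oner_neq0.
Qed.

Lemma minpoly_exists K f : (exists P, [/\ poly_over K P, P \is monic & P.[f] =m 0]) ->
  exists p, is_minpoly K f p.
Proof.
move=> [P PP].
pose A k := `[< exists P, [/\ poly_over K P, P \is monic, P.[f] =m 0 & size P = k] >].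
have exA : exists k, A k.
  by exists (size P); apply/asboolP; exists P; case: PP.
case: (ex_minnP exA) => k /asboolP[p [pK pm pf pk]] kmin; exists p; split=> // q qK qm qf.
by rewrite pk; apply: kmin; apply/asboolP; exists q.
Qed.

Lemma subfield_horner K L (q : {poly MF}) g f : subfield K -> subfield L -> K `<=` L ->
  (forall i, q`_i \in clset K) -> L g -> meromorphic f -> q.[cl g] = cl f -> L f.
Proof.
move=> sK sL KL qK Lg mf E; apply/(clsetP sL mf); rewrite -E horner_coef.
have mg : meromorphic g by case: sL => mL _ _ _ _; apply: mL.
have gL : cl g \in clset L by apply/(clsetP sL mg).
pose L' := divring_pred (clset_divring sL).
change (\sum_(i < size q) q`_i * cl g ^+ i \in L').
apply: rpred_sum => i _; apply: rpredM; last exact: rpredX.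
by have /asboolP[h Kh ->] := qK i; apply/asboolP; exists h => //; apply: KL.
Qed.

End SubfieldClass.

(** * The field of rational functions of [phi] *)

Section RationalFunctions.
Variables (R : realType) (n : nat).
Notation C := (Cx R).
Variables (MF : fieldType) (cl : fn R n -> MF) (clQ : mero_class cl).
Variables (phi : 'I_n -> fn R n).
Hypothesis phi_mero : forall k, meromorphic (phi k).

Definition ev (P : mpoly n C) : MF := mmap (clc clQ) (fun j => cl (phi j)) P.

Lemma pullback_meromorphic P : meromorphic (pullback phi P).
Proof. by case: (meval_cl clQ P phi_mero). Qed.

Lemma cl_pullback P : cl (pullback phi P) = ev P.
Proof. by case: (meval_cl clQ P phi_mero). Qed.

Lemma ev_eq0 P : ev P = 0 <-> pullback phi P =m 0.
Proof. by rewrite -cl_pullback; apply/(cl_eq0 clQ)/pullback_meromorphic. Qed.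

Lemma evB P Q : ev (P - Q) = ev P - ev Q. Proof. exact: rmorphB. Qed.
Lemma evM P Q : ev (P * Q) = ev P * ev Q. Proof. exact: rmorphM. Qed.
Lemma ev1 : ev 1 = 1. Proof. exact: rmorph1. Qed.
Lemma evC c : ev (mpolyC n c) = clc clQ c. Proof. exact: mmapC. Qed.
Lemma ev_prod (I : Type) (r : seq I) (P : pred I) (F : I -> mpoly n C) :
  ev (\prod_(i <- r | P i) F i) = \prod_(i <- r | P i) ev (F i).
Proof. exact: rmorph_prod. Qed.

Lemma meromorphic_pdiv P Q : meromorphic (fun u => pullback phi P u / pullback phi Q u) /\
  cl (fun u => pullback phi P u / pullback phi Q u) = ev P / ev Q.
Proof.
have mP := pullback_meromorphic P; have mQ := pullback_meromorphic Q.
rewrite -!cl_pullback -(clV clQ mQ) -(clM clQ mP (meromorphicV mQ)); split=> //.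
exact: meromorphicM mP (meromorphicV mQ).
Qed.

Lemma ratfieldP f : meromorphic f ->
  ratfield phi f <-> exists P Q, ev Q != 0 /\ cl f = ev P / ev Q.
Proof.
move=> mf; split=> -[P [Q [Q0 E]]]; exists P, Q; have [md dE] := meromorphic_pdiv P Q.
  by split; [apply/eqP => /ev_eq0|rewrite -dE; apply/(cl_eqP clQ)].
by split; [move=> /ev_eq0/eqP; apply/negP|apply/(cl_eqP clQ mf md); rewrite dE].
Qed.

Lemma ratfield_meromorphic f : ratfield phi f -> meromorphic f.
Proof.
move=> [P [Q [_ fE]]]; have [md _] := meromorphic_pdiv P Q.
exact: meromorphic_eqm (eqm_sym fE) md.
Qed.

Lemma ratfield_cst c : ratfield phi (fun=> c).
Proof.
apply/(ratfieldP (meromorphic_cst _)); exists (mpolyC n c), 1.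
by rewrite ev1 oner_neq0 divr1 evC.
Qed.

Lemma ratfield_subfield : subfield (ratfield phi).
Proof.
split; first exact: ratfield_meromorphic.
- move=> f g fg [P [Q [Q0 E]]]; exists P, Q; split=> //.
  exact: eqm_trans (eqm_sym fg) E.
- exact: ratfield_cst.
- move=> f g Kf Kg; have mf := ratfield_meromorphic Kf; have mg := ratfield_meromorphic Kg.
  have [P [Q [Q0 fE]]] := (ratfieldP mf).1 Kf.
  have [P' [Q' [Q0' gE]]] := (ratfieldP mg).1 Kg.
  split; [apply/(ratfieldP (meromorphicB mf mg))|apply/(ratfieldP (meromorphicM mf mg))].
    exists (P * Q' - P' * Q), (Q * Q').
    by rewrite (clB clQ) // fE gE evB !evM mulf_neq0 //; split=> //;
      rewrite -mulNr addf_div // mulNr.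
  exists (P * P'), (Q * Q').
  by rewrite (clM clQ) // fE gE !evM mulf_neq0 // mulf_div.
move=> f Kf; have mf := ratfield_meromorphic Kf.
have [P [Q [Q0 fE]]] := (ratfieldP mf).1 Kf.
apply/(ratfieldP (meromorphicV mf)); rewrite (clV clQ mf) fE.
(* A null function has a null inverse, represented by 0/1; otherwise the fraction is inverted. *)
have [P0|P0] := eqVneq (ev P) 0.
  by exists 0, 1; rewrite P0 mul0r invr0 ev1 oner_neq0 /ev mmap0 mul0r.
by exists Q, P; rewrite invf_div.
Qed.

Lemma ratfield_phi k : ratfield phi (phi k).
Proof.
apply/(ratfieldP (phi_mero k)); exists (mpolyX C (mnm1 k)), 1.
by rewrite ev1 oner_neq0 divr1 /ev mmapX mmap1U.
Qed.

(** The common denominator [D] is the product of the denominators of all coefficients; coefficient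
    [i] of [V] is its numerator times the other denominators. *)
Lemma clear_denominators (p : {poly fn R n}) : poly_over (ratfield phi) p ->
  exists (V : {poly mpoly n C}) D, ~ pullback phi D =m 0 /\
    forall i, pullback phi V`_i =m pullback phi D * p`_i.
Proof.
move=> pK.
have H i : exists PQ : mpoly n C * mpoly n C, ev PQ.2 != 0 /\ cl p`_i = ev PQ.1 / ev PQ.2.
  have [P [Q PQ]] := (ratfieldP (ratfield_meromorphic (pK i))).1 (pK i).
  by exists (P, Q).
have [c cP] := choice H.
pose D := \prod_(j < size p) (c j).2.
pose V := \poly_(i < size p) ((c i).1 * \prod_(j < size p | j != i :> nat) (c j).2).
have D0 : ev D != 0.
  by rewrite ev_prod; apply/prodf_neq0 => j _; case: (cP j).
exists V, D; split=> [/ev_eq0/eqP|i]; first exact/negP.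
have mp := ratfield_meromorphic (pK i).
apply/(cl_eqP clQ (pullback_meromorphic _) (meromorphicM (pullback_meromorphic _) mp)).
rewrite (clM clQ (pullback_meromorphic _) mp) !cl_pullback coef_poly.
case: ltnP => ip; last by rewrite nth_default // (cl0 clQ) mulr0 /ev mmap0.
have [Q0 ->] := cP i; rewrite evM !ev_prod [in RHS](bigD1 (Ordinal ip)) //=.
by field.
Qed.

Lemma cleared_minpoly_root theta V : cleared_minpoly phi theta V ->
  generically (fun u => (map_poly (meval (fun j => phi j u)) V).[theta u] = 0).
Proof.
move=> [p [D [[_ _ pt _] _ VD]]].
(* The definition of [cleared_minpoly] lets [V] and [p] have different sizes, the extra coefficients
   being null after pullback; both sums run up to the larger size. *)
pose N := maxn (size V) (size p).
have gV : generically (fun u => forall i : 'I_N,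
    pullback phi V`_i u = pullback phi D u * (p`_i u)).
  by apply: generically_all => i; apply: VD.
apply: generically_imp2 pt gV => u pu Vu.
rewrite (@horner_coef_wide _ N); last first.
  by apply: leq_trans (size_poly _ _) _; apply: leq_maxl.
have pE : p.[theta] u = \sum_(i < N) p`_i u * theta u ^+ i.
  rewrite (@horner_coef_wide _ N) ?leq_maxr // fct_sumE.
  by apply: eq_bigr => i _; rewrite mulrfctE exprfctE.
rewrite pE in pu; transitivity (pullback phi D u * \sum_(i < N) p`_i u * theta u ^+ i).
  rewrite mulr_sumr; apply: eq_bigr => i _; rewrite coef_map /=.
  by have := Vu i; rewrite /pullback => ->; rewrite mulrA.
by rewrite pu mulr0.
Qed.

End RationalFunctions.

(** * The extension generated by the partial derivatives *)

Section PrimitiveElement.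
Variables (R : realType) (n : nat).
Notation C := (Cx R).
Variables (MF : fieldType) (cl : fn R n -> MF) (clQ : mero_class cl).
Variables (phi : 'I_n -> fn R n).
Hypothesis phi_mero : forall k, meromorphic (phi k).
Hypothesis partial_algebraic : forall k p,
  algebraic_elt (clset cl (ratfield phi)) (cl (partial p (phi k))).

Let K := ratfield phi.
Let S := [set f | exists k p, f = partial p (phi k)].
Let F := adjoin K S.

Let sK : subfield K := ratfield_subfield clQ phi_mero.

Let K_mero f : K f -> meromorphic f.
Proof. by case: sK => mK _ _ _ _; apply: mK. Qed.

Let S_mero f : S f -> meromorphic f.
Proof. by move=> [k [p ->]]; apply: meromorphic_partial. Qed.

Let sF : subfield F := adjoin_subfield K_mero S_mero.

Let KF : K `<=` F.
Proof. by move=> f Kf L _ KL _; apply: KL. Qed.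

Let SF : S `<=` F.
Proof. by move=> f Sf L _ _ SL; apply: SL. Qed.

Lemma adjoin_algebraic : algebraic_extension K F.
Proof.
split=> // f Ff.
have [] := Ff _ (algebraic_subfield clQ sK).
- move=> g Kg; have mg := K_mero Kg; split=> //.
  by apply: (algebraic_elt_id (clset_divring clQ sK)); apply/(clsetP clQ sK).
- by move=> g Sg; split; [exact: S_mero|case: Sg => k [p ->]; apply: partial_algebraic].
move=> mf af; have [P [PK Pm Pf]] := algebraic_elt_monic clQ sK mf af.
exact: monic_algebraic_over PK Pm Pf.
Qed.

Lemma lin_comb_partials_cl (alpha : 'M[C]_n) :
  meromorphic (lin_comb_partials phi alpha) /\
  cl (lin_comb_partials phi alpha) =
    \sum_k \sum_p clc clQ (alpha k p) * cl (partial p (phi k)).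
Proof.
have mt k p : meromorphic ((fun=> alpha k p) * partial p (phi k)).
  by apply: meromorphicM; [apply: meromorphic_cst|apply: meromorphic_partial].
have -> : lin_comb_partials phi alpha =
    \sum_k \sum_p (fun=> alpha k p) * partial p (phi k).
  by apply/funext => u; rewrite /lin_comb_partials fct_sumE;
    apply: eq_bigr => k _; rewrite fct_sumE.
have ms k := cl_sum clQ (index_enum 'I_n) (mt k).
have [mss ->] := cl_sum clQ (index_enum 'I_n) (fun k => (ms k).1).
split=> //; apply: eq_bigr => k _; rewrite (ms k).2; apply: eq_bigr => p _.
by rewrite (clM clQ) //; [apply: meromorphic_cst|apply: meromorphic_partial].
Qed.

Lemma lin_comb_partials_in L alpha : subfield L -> K `<=` L -> S `<=` L ->
  L (lin_comb_partials phi alpha).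
Proof.
move=> sL KL SL; have [mt tE] := lin_comb_partials_cl alpha.
apply/(clsetP clQ sL mt); rewrite tE.
pose L' := divring_pred (clset_divring clQ sL).
change (\sum_k \sum_p clc clQ (alpha k p) * cl (partial p (phi k)) \in L').
apply: rpred_sum => k _; apply: rpred_sum => p _; apply: rpredM; apply/asboolP.
  by exists (fun=> alpha k p) => //; apply: KL; apply: (ratfield_cst clQ phi_mero).
by exists (partial p (phi k)) => //; apply: SL; exists k, p.
Qed.

Lemma exists_primitive_lin_comb :
  exists alpha, primitive_element K F (lin_comb_partials phi alpha).
Proof.
(* The subring of constants: it makes the coefficients of the primitive element complex numbers. *)
pose A : {pred MF} := fun a => `[< exists c, a = clc clQ c >].
have clA : subring_closed A.
  split=> [|a b /asboolP[x ->] /asboolP[y ->]|a b /asboolP[x ->] /asboolP[y ->]]; apply/asboolP.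
  - by exists 1; rewrite rmorph1.
  - by exists (x - y); rewrite rmorphB.
  - by exists (x * y); rewrite rmorphM.
have AK : {subset A <= clset cl K}.
  move=> a /asboolP[c ->]; apply/asboolP; exists (fun=> c) => //.
  exact: (ratfield_cst clQ phi_mero).
have [|a aA aq] := @algebraic_primitive MF _ (clset_divring clQ sK) ('I_n * 'I_n)%type
  (index_enum _) (fun kp => cl (partial kp.2 (phi kp.1))) A (merofield_char0 clQ)
  (index_enum_uniq _) _ clA AK; first by move=> kp _; apply: partial_algebraic.
have aE kp : exists c, a kp = clc clQ c by apply/asboolP; apply: aA.
have [c cE] := choice aE.
exists (\matrix_(k, p) c (k, p)); set theta := lin_comb_partials _ _.
have [mt tE] : meromorphic theta /\ cl theta = _ := lin_comb_partials_cl _.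
have {}tE : cl theta = \sum_kp a kp * cl (partial kp.2 (phi kp.1)).
  rewrite tE pair_big; apply: eq_bigr => -[k p] _ /=; by rewrite mxE cE.
have Ft : F theta by move=> L sL KL SL; apply: lin_comb_partials_in.
split=> //; apply/seteqP; split=> f Ff L sL KL SL.
  apply: Ff => // _ [k [p ->]].
  (* Each partial derivative is a polynomial in [theta] over [K], hence lies in every subfield
     containing [K] and [theta]. *)
  have [q qK qE] := aq (k, p) (mem_index_enum _).
  apply: (subfield_horner clQ sK sL KL qK (SL _ erefl)).
    by apply: S_mero; exists k, p.
  by rewrite tE.
by apply: Ff => // _ ->; apply: Ft.
Qed.

Lemma primitive_extension :
  simple_algebraic_extension K F /\
  exists alpha : 'M[Cx R]_n,
    let theta := lin_comb_partials phi alpha in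
    [/\ primitive_element K F theta,
        exists V, cleared_minpoly phi theta V
      & forall V, cleared_minpoly phi theta V ->
          generically (fun u =>
            (map_poly (meval (fun j => phi j u)) V).[theta u] = 0)].
Proof.
have [alpha prim] := exists_primitive_lin_comb.
split; first by split; [exact: adjoin_algebraic|exists (lin_comb_partials phi alpha)].
exists alpha => theta; split=> //; last exact: cleared_minpoly_root.
have [Ft _] := prim.
have [mt at_] : [set f | meromorphic f /\ algebraic_elt (clset cl K) (cl f)] theta.
  apply: Ft; first exact: algebraic_subfield.
  - move=> g Kg; have mg := K_mero Kg; split=> //.
    by apply: (algebraic_elt_id (clset_divring clQ sK)); apply/(clsetP clQ sK).
  - by move=> g Sg; split; [exact: S_mero|case: Sg => k [p ->]; apply: partial_algebraic].
have [p pmin] := minpoly_exists (algebraic_elt_monic clQ sK mt at_).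
have [pK _ _ _] := pmin.
have [V [D [D0 VD]]] := clear_denominators clQ phi_mero pK.
by exists V, p, D.
Qed.

End PrimitiveElement.

(** * Continuity and derivatives of polynomials in several functions *)

Lemma continuous_meval (K : numFieldType) (T : topologicalType) (m : nat) (h : 'I_m -> T -> K)
    (P : mpoly m K) (a : T) :
    (forall i, {for a, continuous (h i)}) ->
  {for a, continuous (fun x => meval (fun i => h i x) P)}.
Proof.
move=> ch; elim/mpoly_ring_ind: P => [c|i|P Q cP cQ|P Q cP cQ].
- rewrite (_ : (fun x => _) = fun=> c); first exact: cst_continuous.
  by apply/funext => x; rewrite mevalC.
- by rewrite (_ : (fun x => _) = h i) //; apply/funext => x; rewrite mevalXU.
- rewrite (_ : (fun x => _) = (fun x => meval (fun i => h i x) P) +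
    (fun x => meval (fun i => h i x) Q)).
    exact: continuousD.
  by apply/funext => x; rewrite mevalD.
rewrite (_ : (fun x => _) = (fun x => meval (fun i => h i x) P) \*
    (fun x => meval (fun i => h i x) Q)).
  exact: continuousM.
by apply/funext => x; rewrite mevalM.
Qed.

Lemma is_derive_meval (K : numFieldType) (V : normedModType K) (m : nat) (h : 'I_m -> V -> K)
    (P : mpoly m K) (a v : V) : (forall i, derivable (h i) a v) ->
  is_derive a v (fun x => meval (fun i => h i x) P)
    (\sum_i meval (fun j => h j a) (mderiv i P) * 'D_v (h i) a).
Proof.
move=> dh; elim/mpoly_ring_ind: P => [c|i|P Q dP dQ|P Q dP dQ].
- rewrite (_ : (fun x => _) = cst c); last by apply/funext => x; rewrite mevalC.
  rewrite big1; first exact: is_derive_cst.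
  by move=> i _; rewrite mderivC meval0 mul0r.
- rewrite (_ : (fun x => _) = h i); last by apply/funext => x; rewrite mevalXU.
  rewrite (bigD1 i) //= big1 => [|j ji]; last first.
    by rewrite mderivX mnm1E eq_sym (negbTE ji) scale0r meval0 mul0r.
  have subU : mnm_sub (mnm1 i) (mnm1 i) = mnm0 by rewrite -{1}[mnm1 i]add0m addmK.
  rewrite mderivX mnm1E eqxx subU mpolyX0 scale1r meval1 mul1r addr0.
  exact/derivableP.
- rewrite (_ : (fun x => _) = (fun x => meval (fun i => h i x) P) +
    (fun x => meval (fun i => h i x) Q)).
    under eq_bigr do rewrite mderivD mevalD mulrDl.
    by rewrite big_split; apply: is_deriveD.
  by apply/funext => x; rewrite mevalD.
rewrite (_ : (fun x => _) = (fun x => meval (fun i => h i x) P) *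
    (fun x => meval (fun i => h i x) Q)).
  under eq_bigr do rewrite mderivM mevalD !mevalM mulrDl mulrAC -[X in _ + X]mulrA.
  rewrite big_split -mulr_suml -mulr_sumr /=.
  have [dPQ PQE] := is_deriveM dP dQ; apply: DeriveDef; first exact: dPQ.
  by rewrite PQE addrC; congr (_ + _); exact: mulrC.
by apply/funext => x; rewrite mevalM.
Qed.

Lemma derive_shift (K : numFieldType) (V W : normedModType K) (f : V -> W) (a w v : V) :
  'D_v (fun x => f (x + w)) a = 'D_v f (a + w).
Proof.
have E : (fun h : K => h^-1 *: (((fun x => f (x + w)) \o shift a) (h *: v) - f (a + w))) =
    fun h : K => h^-1 *: ((f \o shift (a + w)) (h *: v) - f (a + w)).
  by apply/funext => h /=; rewrite addrA.
by rewrite /derive E.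
Qed.

Section RegularMore.
Variables (R : realType) (n : nat).
Notation C := (Cx R).
Implicit Types (f g h : fn R n) (a z w : 'rV[C]_n).

Lemma regular_cst (c : C) a : regular ((fun=> c) : fn R n) a.
Proof.
exists setT, (fun=> c), (fun=> 1); split; [exact: openT|by []|move=> z _].
split; [exact: holomorphic_cst|exact: holomorphic_cst|exact: oner_neq0|by rewrite divr1].
Qed.

Lemma regular_shift f w a : regular f (a + w) -> regular (fun u => f (u + w)) a.
Proof.
move=> [U [g [h [oU Ua H]]]].
exists ((fun u : 'rV[C]_n => u + w) @^-1` U), (fun u => g (u + w)), (fun u => h (u + w)).
split; [by apply: open_comp => // u _; apply: shift_continuous|exact: Ua|].
move=> z /H[gz hz h0 E]; split.
- exact: holomorphic_shift.
- exact: holomorphic_shift.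
- exact: h0.
exact: E.
Qed.

(** A nonzero value would persist on an open set, which meets the dense set of zeros. Generic
    identities thus become exact at regular points. *)
Lemma eqm0_continuous f a : f =m 0 -> {for a, continuous f} -> f a = 0.
Proof.
move=> f0 cf; apply/eqP; apply: contraT => fa.
have nz : \forall z \near a, f z != 0.
  have := cf => /(_ [set c | c != 0]); apply.
  apply/nbhs_ballP; exists `|f a| => /= [|c]; first by rewrite normr_gt0.
  by rewrite /ball /=; apply: contraTneq => ->; rewrite subr0 ltxx.
have [||z [Oz fz _]] := @generically_near _ _ a (interior [set z | f z != 0]) f0.
- exact: open_interior.
- exact: nz.
by have := interior_subset Oz; rewrite /= fz eqxx.
Qed.

End RegularMore.

(** * The addition theorem *)

Section AdditionTheorem.
Variables (R : realType) (n : nat).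
Notation C := (Cx R).
Variables (phi : 'I_n -> fn R n).
Hypothesis phi_mero : forall k, meromorphic (phi k).
Implicit Types (u v w : 'rV[C]_n) (P G : mpoly (1 + (n + n)) C).

Definition iL : 'I_(1 + (n + n)) := lshift (n + n) ord0.
Definition iX (j : 'I_n) : 'I_(1 + (n + n)) := rshift 1 (lshift n j).
Definition iY (j : 'I_n) : 'I_(1 + (n + n)) := rshift 1 (rshift n j).

Lemma aat_ind (T : 'I_(1 + (n + n)) -> Prop) :
  T iL -> (forall j, T (iX j)) -> (forall j, T (iY j)) -> forall i, T i.
Proof.
move=> TL TX TY i; rewrite -(splitK i); case: (fintype.split i) => [l|l] /=.
  by rewrite ord1.
by rewrite -(splitK l); case: (fintype.split l) => j /=; [apply: TX|apply: TY].
Qed.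

Definition pt k u v : 'I_(1 + (n + n)) -> C :=
  fun i => row_mx (phi k (u + v))%:M (row_mx (Phi phi u) (Phi phi v)) 0 i.

Lemma ptL k u v : pt k u v iL = phi k (u + v).
Proof. by rewrite /pt row_mxEl mxE eqxx mulr1n. Qed.
Lemma ptX k u v j : pt k u v (iX j) = phi j u.
Proof. by rewrite /pt row_mxEr row_mxEl mxE. Qed.
Lemma ptY k u v j : pt k u v (iY j) = phi j v.
Proof. by rewrite /pt row_mxEr row_mxEr mxE. Qed.

(* The coordinates of [pt] as functions of one of the two points: the first one
   if [b] is false, the second one if [b] is true. *)
Definition coord (b : bool) k w (i : 'I_(1 + (n + n))) : fn R n :=
  fun u => if b then pt k w u i else pt k u w i.

Definition moving (b : bool) j := if b then iY j else iX j.
Definition fixed (b : bool) j := if b then iX j else iY j.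

Lemma coordL b k w : coord b k w iL = fun u => phi k (u + w).
Proof. by apply/funext => u; rewrite /coord; case: b; rewrite ptL // addrC. Qed.
Lemma coord_moving b k w j : coord b k w (moving b j) = phi j.
Proof. by apply/funext => u; rewrite /coord; case: b; rewrite ?ptX ?ptY. Qed.
Lemma coord_fixed b k w j : coord b k w (fixed b j) = fun=> phi j w.
Proof. by apply/funext => u; rewrite /coord; case: b; rewrite ?ptX ?ptY. Qed.

Lemma aat_ind_moving b (T : 'I_(1 + (n + n)) -> Prop) :
  T iL -> (forall j, T (moving b j)) -> (forall j, T (fixed b j)) -> forall i, T i.
Proof. by case: b => TL TM TF; apply: aat_ind. Qed.

Lemma aat_sum b (M : nmodType) (F : 'I_(1 + (n + n)) -> M) :
  \sum_i F i = F iL + (\sum_j F (moving b j) + \sum_j F (fixed b j)).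
Proof.
rewrite big_split_ord big_ord1 big_split_ord /=; congr (_ + _).
by case: b => //=; rewrite addrC.
Qed.

Definition reg u := forall j, regular (phi j) u.

Lemma reg_generically : generically reg.
Proof. by apply: generically_all => j; apply: meromorphic_regular. Qed.

Lemma reg_near u : reg u -> \forall z \near u, reg z.
Proof.
move=> ru; apply: (filter_forall (nbhs_filter u)) => j.
by apply: open_nbhs_nbhs; split; [apply: regular_open|apply: ru].
Qed.

Lemma coord_meromorphic b k w i : meromorphic (coord b k w i).
Proof.
move: i; apply: (@aat_ind_moving b) => [|j|j];
  rewrite ?coordL ?coord_moving ?coord_fixed //.
  exact: meromorphic_shift.
exact: meromorphic_cst.
Qed.

Lemma coord_regular b k w i u : reg u -> reg (u + w) -> regular (coord b k w i) u.
Proof.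
move=> ru ruw; move: i; apply: (@aat_ind_moving b) => [|j|j];
  rewrite ?coordL ?coord_moving ?coord_fixed //.
  exact: regular_shift.
exact: regular_cst.
Qed.

Definition rel b k w P : fn R n := fun u => meval (fun i => coord b k w i u) P.

Lemma relE b k w P u : rel b k w P u = meval (if b then pt k w u else pt k u w) P.
Proof. by rewrite /rel /coord; case: b. Qed.

Lemma rel_meromorphic b k w P : meromorphic (rel b k w P).
Proof.
have [MF [cl clQ]] := mero_class_exists R n.
by case: (meval_cl clQ P (coord_meromorphic b k w)).
Qed.

Lemma rel_continuous b k w P u : reg u -> reg (u + w) -> {for u, continuous (rel b k w P)}.
Proof.
move=> ru ruw; apply: (@continuous_meval _ _ _ (coord b k w)) => i.
exact: regular_continuous (coord_regular _ _ _ ru ruw).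
Qed.

(** The fixed coordinates are constants and drop out of the chain rule; the lambda coordinate is
    [phi k (u + w)] whichever argument moves. *)
Lemma rel_partial b k w P p u : reg u -> reg (u + w) ->
  partial p (rel b k w P) u =
    rel b k w (mderiv iL P) u * partial p (phi k) (u + w) +
    \sum_j rel b k w (mderiv (moving b j) P) u * partial p (phi j) u.
Proof.
move=> ru ruw.
have dh i : derivable (coord b k w i) u (delta_mx 0 p).
  exact: regular_derivable (coord_regular _ _ _ ru ruw).
have [_ E] := is_derive_meval P dh.
rewrite /partial [LHS]E (aat_sum b) coordL derive_shift; congr (_ + _).
rewrite [X in _ + X]big1 ?addr0 => [|j _].
  by apply: eq_bigr => j _; rewrite coord_moving.
by rewrite coord_fixed derive_cst mulr0.
Qed.

(** Required at all regular triples and not just generically in [(u, v)], so that either point can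
    be fixed at any regular value. *)
Definition vanishes k P := forall u v, reg u -> reg v -> reg (u + v) -> meval (pt k u v) P = 0.

Lemma vanishes_rel b k P w : reg w ->
  vanishes k P -> forall u, reg u -> reg (u + w) -> rel b k w P u = 0.
Proof.
by move=> rw V u ru ruw; rewrite relE; case: b; apply: V => //; rewrite addrC.
Qed.

Lemma rel_eqm0 b k w P u : rel b k w P =m 0 -> reg u -> reg (u + w) -> rel b k w P u = 0.
Proof. by move=> P0 ru ruw; apply: (eqm0_continuous P0); apply: rel_continuous. Qed.

Lemma generically_reg2 w : generically (fun u => reg u /\ reg (u + w)).
Proof.
by apply: generically_and; [|apply: generically_shift]; apply: reg_generically.
Qed.

Lemma rel_vanishes b k P : (forall w, reg w -> rel b k w P =m 0) -> vanishes k P.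
Proof.
case: b => H u v ru rv ruv.
  by have := rel_eqm0 (H _ ru) rv; rewrite relE addrC => ->.
by have := rel_eqm0 (H _ rv) ru; rewrite relE => ->.
Qed.

(** The dense open set contains a product [A * B] of neighbourhoods. The identity theorem extends
    the relation from [A] to all [u] for each [v] in [B], then from [B] to all [v] for each regular
    [u]. *)
Lemma generically_vanishes k P :
  generically (fun uv : 'rV[C]_n * 'rV[C]_n => meval (pt k uv.1 uv.2) P = 0) ->
  vanishes k P.
Proof.
move=> [W [oW dW WP]].
have [[u0 v0] [_ W0]] := dW setT (ex_intro _ (0, 0) I) openT.
have [[A B] /= [nA nB] AB] : nbhs (u0, v0) W by apply: open_nbhs_nbhs.
have loc (A' : set 'rV[C]_n) (a : 'rV[C]_n) (f : fn R n) : nbhs a A' -> meromorphic f ->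
    generically (fun u => A' u -> f u = 0) -> f =m 0.
  move=> nA' mf gf; apply: meromorphic_identity mf _.
  exists a, (interior A'); split; [exact: open_interior|exact: nA'|].
  by apply: generically_imp gf => u fu /interior_subset /fu.
have HB v : B v -> rel false k v P =m 0.
  move=> Bv; apply: (loc A u0 _ nA (rel_meromorphic _ _ _ _)).
  apply: generically_true => u Au; rewrite relE.
  exact: (WP (u, v) (AB (u, v) (conj Au Bv))).
apply: (@rel_vanishes true) => u ru.
apply: (loc B v0 _ nB (rel_meromorphic _ _ _ _)).
apply: generically_imp (generically_reg2 u) => v [rv rvu] Bv.
by have := rel_eqm0 (HB v Bv) ru; rewrite !relE addrC => ->.
Qed.

(** One pair [(u, v)] with nonzero value suffices: with this [u] fixed, the relation is a nonzero
    meromorphic function of [v], hence generically nonzero. *)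
Lemma not_vanishes_generically k P : ~ vanishes k P ->
  generically (fun v => exists u, [/\ reg u, reg (u + v) & meval (pt k u v) P != 0]).
Proof.
move=> nV; have [u [v [ru rv ruv Pv]]] : exists u v,
    [/\ reg u, reg v, reg (u + v) & meval (pt k u v) P != 0].
  apply: contrapT => H; apply: nV => u v ru rv ruv; apply/eqP; apply: contraT => Pv.
  by case: H; exists u, v.
have n0 : ~ rel true k u P =m 0.
  move=> /rel_eqm0 /(_ rv); rewrite addrC relE => /(_ ruv) E.
  by rewrite E eqxx in Pv.
apply: generically_imp2 (meromorphic_neq0 (rel_meromorphic _ _ _ _) n0) (generically_reg2 u).
by move=> z; rewrite relE => Pz [rz rzu]; exists u; split=> //; rewrite addrC.
Qed.

End AdditionTheorem.

Section MpolyDeriv.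
Variables (K : numFieldType) (m : nat).
Implicit Types P : mpoly m K.

Lemma msize_deriv i P : P != 0 -> (mmeasure mdeg (mderiv i P) < mmeasure mdeg P)%N.
Proof.
move=> P0; rewrite (mpolySpred mdeg P0) ltnS msizeE big_seq.
apply: (big_ind (fun x => x <= (mmeasure mdeg P).-1)%N) => [//|x y xN yN|l].
  by rewrite geq_max xN.
rewrite mcoeff_msupp mcoeff_deriv => lP.
have : mnm_add l (mnm1 i) \in msupp P.
  by rewrite mcoeff_msupp; apply: contraNneq lP => ->; rewrite mul0rn.
move=> /msize_mdeg_lt; rewrite mdegD mdeg1 addn1 {1}(mpolySpred mdeg P0) ltnS => h.
exact: h.
Qed.

(** If [l i] is positive, the coefficient of [P] at [l] reappears in the derivative in [i],
    multiplied by [l i], which is nonzero in characteristic 0. *)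
Lemma mderiv_eq0 P : (forall i, mderiv i P = 0) -> P = mpolyC m (mcoeff mnm0 P).
Proof.
move=> dP; apply/mpolyP => l; rewrite mcoeffC.
have [->|l0] := eqVneq l mnm0; first by rewrite mulr1.
rewrite mulr0; have [i li] : exists i, l i != 0%N.
  apply/existsP; rewrite -negb_forall; apply: contraNN l0 => /forallP l0.
  by apply/eqP/mnmP => i; rewrite mnm0E; apply/eqP.
have := mcoeff_deriv i (mnm_sub l (mnm1 i)) P.
rewrite dP mcoeff0 submK ?lep1mP // => /esym/eqP.
by rewrite mulrn_eq0 /= => /eqP.
Qed.

End MpolyDeriv.

(** * Relations of minimal degree *)

Section AAT.
Variables (R : realType) (n : nat).
Notation C := (Cx R).
Variables (MF : fieldType) (cl : fn R n -> MF) (clQ : mero_class cl).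
Variables (phi : 'I_n -> fn R n).
Hypothesis phi_mero : forall k, meromorphic (phi k).
Hypothesis phi_indep : analytically_independent phi.
Implicit Types (u v w : 'rV[C]_n) (P G : mpoly (1 + (n + n)) C).

Lemma cl_prod (I : Type) (r : seq I) (F : I -> fn R n) :
    (forall i, meromorphic (F i)) ->
  meromorphic (\prod_(i <- r) F i) /\ cl (\prod_(i <- r) F i) = \prod_(i <- r) cl (F i).
Proof.
move=> mF; elim: r => [|i r [mr Er]].
  by rewrite !big_nil (cl1 clQ); split; [apply: meromorphic_cst|].
by rewrite !big_cons -Er -(clM clQ) //; split; [apply: meromorphicM|].
Qed.

Lemma cl_det (M : 'I_n -> 'I_n -> fn R n) : (forall i j, meromorphic (M i j)) ->
  meromorphic (fun u => \det (\matrix_(i, j) M i j u)) /\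
  cl (fun u => \det (\matrix_(i, j) M i j u)) = \det (\matrix_(i, j) cl (M i j)).
Proof.
move=> mM.
have -> : (fun u => \det (\matrix_(i, j) M i j u)) =
    \sum_(s : 'S_n) (fun=> (-1) ^+ s : C) * \prod_i M i (s i).
  apply/funext => u; rewrite /determinant fct_sumE; apply: eq_bigr => s _.
  by rewrite mulrfctE fct_prodE; congr (_ * _); apply: eq_bigr => i _; rewrite mxE.
have mp s := cl_prod (index_enum 'I_n) (fun i => mM i (s i)).
have mt (s : 'S_n) : meromorphic ((fun=> (-1) ^+ s) * \prod_i M i (s i)).
  by apply: meromorphicM; [apply: meromorphic_cst|case: (mp s)].
have [ms ->] := cl_sum clQ (index_enum 'S_n) mt; split=> //.
apply: eq_bigr => s _; rewrite (clM clQ) ?(mp s).2; [|exact: meromorphic_cst|by case: (mp s)].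
rewrite (_ : cl _ = clc clQ ((-1) ^+ s)) // rmorphXn rmorphN rmorph1.
by congr (_ * _); apply: eq_bigr => i _; rewrite mxE.
Qed.

(** The Jacobian matrix of the translate of [phi] by [w], over the field of classes; locked so that
    conversion does not unfold its entries. *)
Definition jac w : 'M[MF]_n :=
  locked (\matrix_(k, p) cl (fun u => partial p (phi k) (u + w))).

Lemma jacE w k p : jac w k p = cl (fun u => partial p (phi k) (u + w)).
Proof. by rewrite /jac -lock [LHS]mxE. Qed.

Lemma jac0E k p : jac 0 k p = cl (partial p (phi k)).
Proof.
have E : (fun u => partial p (phi k) (u + 0)) = partial p (phi k).
  by apply/funext => u; rewrite (addr0 u).
by rewrite jacE E.
Qed.

Lemma det_jac_neq0 w : \det (jac w) != 0.
Proof.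
rewrite /jac -lock; have [md <-] := cl_det
  (fun k p => meromorphic_shift w (meromorphic_partial p (phi_mero k))).
apply/eqP => /(cl_eq0 clQ md) H; apply: phi_indep.
apply: generically_imp (generically_shift (- w) H) => u.
by rewrite subrK.
Qed.

Lemma partial_rel0 b k w P p u : vanishes phi k P -> reg phi w -> reg phi u ->
  reg phi (u + w) -> partial p (rel phi b k w P) u = 0.
Proof.
move=> V rw ru ruw; rewrite /partial (@near_eq_derive _ _ _ _ (cst 0)) ?derive_cst //.
have := shift_continuous (reg_near ruw); apply: filterS2 (reg_near ru) => z rz rzw.
exact: (vanishes_rel b rw V rz rzw).
Qed.

(** Keeping [y] apart from [u + w] allows the sum to be written in the other order, as is needed
    when the second argument moves. *)
Lemma rel_relation b k w P p u y : vanishes phi k P -> reg phi w -> reg phi u ->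
    reg phi y -> y = u + w ->
  rel phi b k w (mderiv (iL n) P) u * partial p (phi k) y +
  \sum_j rel phi b k w (mderiv (moving b j) P) u * partial p (phi j) u = 0.
Proof. by move=> V rw ru + yE; rewrite yE => ry; rewrite -rel_partial // partial_rel0. Qed.

Lemma fct_sum_at (I : finType) (F : I -> fn R n) u : (\sum_i F i) u = \sum_i F i u.
Proof. by rewrite fct_sumE. Qed.

Lemma cl_rel_partial0 b k w P p : vanishes phi k P -> reg phi w ->
  cl (rel phi b k w (mderiv (iL n) P)) * jac w k p +
  \sum_j cl (rel phi b k w (mderiv (moving b j) P)) * jac 0 j p = 0.
Proof.
move=> V rw.
have mr Q : meromorphic (rel phi b k w Q) by apply: rel_meromorphic.
have mp j := meromorphic_partial p (phi_mero j).
have [ms Es] := cl_sum clQ (index_enum 'I_n)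
  (fun j => meromorphicM (mr (mderiv (moving b j) P)) (mp j)).
transitivity (cl (rel phi b k w (mderiv (iL n) P) * (fun u => partial p (phi k) (u + w)) +
    \sum_j rel phi b k w (mderiv (moving b j) P) * partial p (phi j))).
  have mL := meromorphic_shift w (mp k).
  have EL : cl (rel phi b k w (mderiv (iL n) P) * (fun u => partial p (phi k) (u + w))) =
      cl (rel phi b k w (mderiv (iL n) P)) * jac w k p.
    exact: etrans (clM clQ (mr _) mL) (congr1 (fun x => _ * x) (esym (jacE w k p))).
  have Ej j : cl (rel phi b k w (mderiv (moving b j) P) * partial p (phi j)) =
      cl (rel phi b k w (mderiv (moving b j) P)) * jac 0 j p.
    exact: etrans (clM clQ (mr _) (mp j)) (congr1 (fun x => _ * x) (esym (jac0E j p))).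
  apply: esym; apply: etrans (clD clQ (meromorphicM (mr _) mL) ms) _.
  exact: (congr2 +%R EL (etrans Es (eq_bigr _ (fun j _ => Ej j)))).
apply/(cl_eq0 clQ).
  exact: (meromorphicD (meromorphicM (mr _) (meromorphic_shift w (mp k))) ms).
apply: generically_imp (generically_reg2 phi_mero w) => u [ru ruw].
exact: etrans (congr1 (fun x => _ + x) (fct_sum_at _ u)) (rel_relation b p V rw ru ruw erefl).
Qed.

Lemma exists_minimal_relation k : (exists G, G != 0 /\ vanishes phi k G) ->
  exists G, [/\ G != 0, vanishes phi k G & forall P,
    (mmeasure mdeg P < mmeasure mdeg G)%N -> vanishes phi k P -> P = 0].
Proof.
move=> [G0 [G00 VG0]].
pose A s := `[< exists G, [/\ G != 0, vanishes phi k G & mmeasure mdeg G = s] >].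
have exA : exists s, A s by exists (mmeasure mdeg G0); apply/asboolP; exists G0.
case: (ex_minnP exA) => s /asboolP[G [Gn VG Gs]] smin; exists G; split=> // P PG VP.
apply/eqP; apply: contraT => P0; move: PG; rewrite Gs ltnNge smin //.
by apply/asboolP; exists P.
Qed.

Lemma minimal_relation_lambda k G : G != 0 -> vanishes phi k G ->
    (forall P, (mmeasure mdeg P < mmeasure mdeg G)%N -> vanishes phi k P -> P = 0) ->
  ~ vanishes phi k (mderiv (iL n) G).
Proof.
move=> G0 VG Gmin VL; have HL : mderiv (iL n) G = 0 by apply: Gmin VL; apply: msize_deriv.
have HM b j : mderiv (moving b j) G = 0.
  apply: Gmin; first exact: msize_deriv.
  apply: (@rel_vanishes R n phi b) => w rw.
  pose r := \row_j cl (rel phi b k w (mderiv (moving b j) G)).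
  (* With the lambda term gone, the differentiated relation says that the row of moving derivatives
     is killed by the Jacobian matrix. *)
  have r0 : r *m jac 0 = 0.
    apply/rowP => p; rewrite !mxE -[RHS](cl_rel_partial0 b p VG rw) HL.
    rewrite (_ : rel phi b k w 0 = 0); last by apply/funext => u; rewrite /rel meval0.
    by rewrite (cl0 clQ) mul0r add0r; apply: eq_bigr => l _; rewrite mxE.
  have Ju : jac 0 \in unitmx by rewrite unitmxE unitfE det_jac_neq0.
  have := congr1 (mulmx^~ (invmx (jac 0))) r0; rewrite mulmxK // mul0mx.
  move=> rE; apply/(cl_eq0 clQ); first exact: rel_meromorphic.
  by move/rowP/(_ j): rE; rewrite [LHS]mxE [RHS]mxE.
have G_cst : G = mpolyC _ (mcoeff mnm0 G).
  apply: mderiv_eq0; apply: aat_ind => [//|j|j]; first exact: (HM false).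
  exact: (HM true).
(* At some regular triple the constant [G] is evaluated and found to be 0. *)
have [u [ru _]] := generically_ex (generically_reg2 phi_mero 0).
have [v [rv rvu]] := generically_ex (generically_reg2 phi_mero u).
have := VG _ _ rv ru rvu; rewrite G_cst mevalC => c0.
by rewrite G_cst c0 mpolyC0 eqxx in G0.
Qed.

End AAT.

(** * Solving the linear system inside a subfield *)

Section LinearSystem.
Variables (L : fieldType) (n : nat) (S0 : {pred L}) (dS : divring_closed S0).
Let S := divring_pred dS.

Lemma det_in m (A : 'M[L]_m) : (forall i j, A i j \in S) -> \det A \in S.
Proof.
move=> HA; rewrite /determinant; apply: rpred_sum => s _.
by apply: rpredM; [apply: rpredX; rewrite rpredN rpred1|apply: rpred_prod].
Qed.

(** In the application [J] and [J'] are the Jacobian matrices of [phi] and of its translate, and [c]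
    is the constant Jacobian matrix at the fixed point. Comparing both equations gives
    [A J = B c]. *)
Lemma linear_system_solution (h : 'I_n -> L) (a b c : 'I_n -> 'I_n -> L) (J J' : 'M[L]_n) :
    (forall k p, h k * J' k p + \sum_j a k j * J j p = 0) ->
    (forall k p, h k * J' k p + \sum_j b k j * c j p = 0) ->
    (forall k, h k != 0) -> \det J' != 0 ->
    (forall k j, a k j \in S0) -> (forall k j, b k j \in S0) -> (forall k j, c k j \in S0) ->
  forall k p, J k p \in S0.
Proof.
move=> HA HB h0 J'0 aS bS cS.
pose A := \matrix_(k, j) a k j; pose B := \matrix_(k, j) b k j.
pose c' := \matrix_(k, j) c k j; pose D := diag_mx (\row_k h k).
have AJ : D *m J' + A *m J = 0.
  apply/matrixP => k p; rewrite [LHS]mxE mul_diag_mx !mxE -[RHS](HA k p).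
  by congr (_ + _); apply: eq_bigr => j _; rewrite mxE.
have BJ : D *m J' + B *m c' = 0.
  apply/matrixP => k p; rewrite [LHS]mxE mul_diag_mx !mxE -[RHS](HB k p).
  by congr (_ + _); apply: eq_bigr => j _; rewrite !mxE.
have Au : A \in unitmx.
  rewrite unitmxE unitfE.
  have : \det (A *m J) != 0.
    have -> : A *m J = - 1 *: (D *m J').
      by rewrite scaleN1r; apply/eqP; rewrite -addr_eq0 addrC AJ.
    rewrite detZ det_mulmx !mulf_neq0 //.
      by rewrite expf_neq0 // oppr_eq0 oner_eq0.
    by rewrite det_diag; apply/prodf_neq0 => k _; rewrite mxE.
  by rewrite det_mulmx mulf_eq0 negb_or => /andP[].
have JE : J = invmx A *m (B *m c').
  have -> : B *m c' = A *m J by apply: (addrI (D *m J')); rewrite AJ.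
  by rewrite mulKmx.
have AS k j : A k j \in S by rewrite mxE; apply: aS.
move=> k p; change (J k p \in S); rewrite JE mxE; apply: rpred_sum => i _; apply: rpredM.
  (* The inverse is expressed by cofactors and the determinant, which are polynomials in the entries
     of [A]. *)
  rewrite /invmx Au mxE; apply: rpredM; first by rewrite rpredV; apply: det_in.
  rewrite mxE /cofactor; apply: rpredM; first by apply: rpredX; rewrite rpredN rpred1.
  by apply: det_in => i' j'; rewrite !mxE; apply: aS.
rewrite mxE; apply: rpred_sum => j _; apply: rpredM; rewrite mxE; [exact: bS|exact: cS].
Qed.

End LinearSystem.

(** * Algebraicity of translates and partial derivatives *)

Section PartialAlgebraic.
Variables (R : realType) (n : nat).
Notation C := (Cx R).
Variables (MF : fieldType) (cl : fn R n -> MF) (clQ : mero_class cl).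
Variables (phi : 'I_n -> fn R n).
Hypothesis phi_mero : forall k, meromorphic (phi k).
Hypothesis phi_indep : analytically_independent phi.
Implicit Types (u v w : 'rV[C]_n) (P G : mpoly (1 + (n + n)) C).

Let S := clset cl (ratfield phi).
Let dS : divring_closed S := clset_divring clQ (ratfield_subfield clQ phi_mero).
Let S' := divring_pred dS.
Let alg : {pred MF} := divring_pred (algebraic_elt_divring dS).

Let S_alg x : x \in S -> x \in alg.
Proof. by move=> xS; apply/asboolP; apply: algebraic_elt_id. Qed.

Let S_cst c : clc clQ c \in S.
Proof. by apply/asboolP; exists (fun=> c) => //; apply: (ratfield_cst clQ phi_mero). Qed.

Lemma cl_rel b k w P :
  cl (rel phi b k w P) = mmap (clc clQ) (fun i => cl (coord phi b k w i)) P.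
Proof. by case: (meval_cl clQ P (coord_meromorphic phi_mero b k w)). Qed.

(** Substituting [phi] and [phi w] for [x] and [y] might annihilate all coefficients of [G]; the
    nonzero derivative in lambda excludes this, so the translate is a root of a nonzero
    polynomial. *)
Lemma shift_algebraic k w G :
    cl (rel phi false k w G) = 0 -> cl (rel phi false k w (mderiv (iL n) G)) != 0 ->
  cl (fun u => phi k (u + w)) \in alg.
Proof.
rewrite !cl_rel => G0 dG0.
pose h i : {poly MF} := if i == iL n then 'X else (cl (coord phi false k w i))%:P.
pose q := mmap (polyC \o clc clQ) h G.
have hS i : h i \is a polyOver S'.
  rewrite /h; case: eqP => [_|]; first exact: polyOverX.
  move: i; apply: (@aat_ind_moving n false) => [//|j _|j _].
    rewrite coord_moving polyOverC; apply/asboolP; exists (phi j) => //.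
    exact: (ratfield_phi clQ phi_mero).
  by rewrite coord_fixed polyOverC; apply: S_cst.
have qS : q \is a polyOver S'.
  rewrite /q; elim/mpoly_ring_ind: (G) => [c|i|P Q PS QS|P Q PS QS].
  - by rewrite mmapC polyOverC; apply: S_cst.
  - by rewrite mmapX mmap1U.
  - by rewrite mmapD rpredD.
  - by rewrite rmorphM rpredM.
pose x := cl (fun u => phi k (u + w)).
pose T (r : {poly MF}) a d := r.[x] = a /\ r^`().[x] = d.
have : T q (mmap (clc clQ) (fun i => cl (coord phi false k w i)) G)
    (\sum_i mmap (clc clQ) (fun i => cl (coord phi false k w i)) (mderiv i G) * (i == iL n)%:R).
  apply: mmap_chain_rule => [c|r a d s a' d' [<- <-] [<- <-]|r a d s a' d' [<- <-] [<- <-]|i];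
    rewrite /T.
  - by rewrite /= derivC !hornerC.
  - by rewrite derivD !hornerD.
  - by rewrite derivM hornerD !hornerM.
  - rewrite /h; case: eqP => [->|_]; first by rewrite derivX hornerX hornerC coordL.
    by rewrite derivC !hornerC.
move=> [qx]; rewrite (bigD1 (iL n)) // big1 => [|i /negbTE->]; last by rewrite mulr0.
rewrite eqxx mulr1 /= addr0 => q'x; apply/asboolP; exists q.
  by apply: contraNneq dG0 => q0; rewrite -q'x q0 deriv0 horner0.
by split; [exact: (polyOverP qS)|rewrite /root qx G0].
Qed.

Lemma rel_algebraic k w P : cl (fun u => phi k (u + w)) \in alg ->
  cl (rel phi false k w P) \in alg.
Proof.
move=> ax; rewrite cl_rel; elim/mpoly_ring_ind: P => [c|i|P Q aP aQ|P Q aP aQ].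
- by rewrite mmapC; apply: S_alg; apply: S_cst.
- rewrite mmapX mmap1U; move: i; apply: (@aat_ind_moving n false) => [|j|j].
  + by rewrite coordL.
  + rewrite coord_moving; apply: S_alg; apply/asboolP; exists (phi j) => //.
    exact: (ratfield_phi clQ phi_mero).
  + by rewrite coord_fixed; apply: S_alg; apply: S_cst.
- by rewrite mmapD rpredD.
by rewrite rmorphM rpredM.
Qed.

(* Here the relation is differentiated in its second argument, which is then
   fixed to [w]. *)
Lemma cl_rel_partial_fixed k w P p : vanishes phi k P -> reg phi w ->
  cl (rel phi false k w (mderiv (iL n) P)) * jac cl phi w k p +
  \sum_j cl (rel phi false k w (mderiv (iY j) P)) * clc clQ (partial p (phi j) w) = 0.
Proof.
move=> V rw.
have mr Q : meromorphic (rel phi false k w Q) by apply: rel_meromorphic.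
have mp := meromorphic_partial p (phi_mero k).
have mc j : meromorphic ((fun=> partial p (phi j) w) : fn R n) by apply: meromorphic_cst.
have mL := meromorphic_shift w mp.
have [ms Es] := cl_sum clQ (index_enum 'I_n) (fun j => meromorphicM (mr (mderiv (iY j) P)) (mc j)).
have EL : cl (rel phi false k w (mderiv (iL n) P) * (fun u => partial p (phi k) (u + w))) =
    cl (rel phi false k w (mderiv (iL n) P)) * jac cl phi w k p.
  exact: etrans (clM clQ (mr _) mL) (congr1 (fun x => _ * x) (esym (jacE _ _ w k p))).
have Ej j : cl (rel phi false k w (mderiv (iY j) P) * (fun=> partial p (phi j) w)) =
    cl (rel phi false k w (mderiv (iY j) P)) * clc clQ (partial p (phi j) w).
  exact: (clM clQ (mr _) (mc j)).
apply: etrans (esym (congr2 +%R EL (etrans Es (eq_bigr _ (fun j _ => Ej j))))) _.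
apply: etrans (esym (clD clQ (meromorphicM (mr _) mL) ms)) _.
apply/(cl_eq0 clQ); first exact: (meromorphicD (meromorphicM (mr _) mL) ms).
apply: generically_imp (generically_reg2 phi_mero w) => u [ru ruw].
exact: etrans (congr1 (fun x => _ + x) (fct_sum_at _ u))
  (rel_relation true p V ru rw ruw (addrC u w)).
Qed.

Lemma partial_algebraic_of_relations :
    (forall k, exists G, G != 0 /\ vanishes phi k G) ->
  forall k p, algebraic_elt S (cl (partial p (phi k))).
Proof.
move=> HG; have min k := exists_minimal_relation (HG k).
have [G GP] := choice min.
(* A single [v] must serve all [k]; the conditions are finitely many and each is generic. *)
have [v [rv Hv]] : exists v, reg phi v /\ forall k, exists u,
    [/\ reg phi u, reg phi (u + v) & meval (pt phi k u v) (mderiv (iL n) (G k)) != 0].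
  apply: generically_ex; apply: generically_and; first exact: reg_generically.
  apply: generically_all => k; apply: not_vanishes_generically => //.
  by have [G0 VG Gmin] := GP k; apply: (minimal_relation_lambda clQ phi_mero phi_indep G0 VG Gmin).
pose H k := cl (rel phi false k v (mderiv (iL n) (G k))).
have H0 k : H k != 0.
  have [u [ru ruv Gu]] := Hv k; apply: contraNneq Gu.
  have mr := rel_meromorphic phi_mero false k v (mderiv (iL n) (G k)).
  by move=> /(cl_eq0 clQ mr) /rel_eqm0 /(_ ru ruv); rewrite relE => ->.
have VG k : vanishes phi k (G k) by case: (GP k).
have psi_alg k : cl (fun u => phi k (u + v)) \in alg.
  apply: (shift_algebraic _ (H0 k)); apply/(cl_eq0 clQ); first exact: rel_meromorphic.
  apply: generically_imp (generically_reg2 phi_mero v) => u [ru ruv].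
  exact: vanishes_rel.
have algI x : x \in alg -> algebraic_elt S x by move/asboolP.
move=> k p; apply: algI; rewrite -(jac0E cl phi k p).
(* The ambient subfield is that of the elements algebraic over [K]. The multipliers [H k] of the
   translate's derivatives are the same in both systems. *)
apply: (linear_system_solution (algebraic_elt_divring dS)
  (fun k p => cl_rel_partial0 clQ phi_mero false p (VG k) rv)
  (fun k p => cl_rel_partial_fixed p (VG k) rv) H0 (det_jac_neq0 clQ phi_mero phi_indep v)).
- by move=> i j; apply: rel_algebraic.
- by move=> i j; apply: rel_algebraic.
- by move=> i j; apply: S_alg; apply: S_cst.
Qed.

End PartialAlgebraic.

Theorem theorem2 (R : realType) (n : nat) (n_gt0 : (0 < n)%N)
    (phi : 'I_n -> fn R n)
    (phi_mero : forall k, meromorphic (phi k))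
    (phi_indep : analytically_independent phi)
    (phi_AAT : AAT phi) :
  let K := ratfield phi in
  let F := adjoin K [set f | exists k p, f = partial p (phi k)] in
  simple_algebraic_extension K F /\
  exists alpha : 'M[Cx R]_n,
    let theta := lin_comb_partials phi alpha in
    [/\ primitive_element K F theta,
        exists V, cleared_minpoly phi theta V
      & forall V, cleared_minpoly phi theta V ->
          generically (fun u =>
            (map_poly (meval (fun j => phi j u)) V).[theta u] = 0)].
Proof.
move=> K F; have [MF [cl clQ]] := mero_class_exists R n.
apply: (primitive_extension clQ phi_mero).
apply: (partial_algebraic_of_relations clQ phi_mero phi_indep) => k.
have [G HG] := phi_AAT; have [G0 GE] := HG k.
by exists (G k); split; [exact: G0|exact: (generically_vanishes phi_mero GE)].
Qed.
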